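(* The following three parameterized problems are in FPT: given a directed graph $G$, nodes $s,t$, and parameter $k\in\mathbb N$, decide whether there is a trail from $s$ to $t$ in $G$ of length exactly $k$; of length at most $k$; of length at least $k$, respectively.
   Context: A trail is a path (sequence of consecutive directed edges) with no repeated edge; its length is its number of edges. A parameterized problem is in FPT if it can be decided in time $f(k)\cdot n^{c}$ for a computable $f$, a constant $c$, and input size $n$. *)

(* Defs.v *)
From mathcomp Require Import all_boot.
Set Implicit Arguments. Unset Strict Implicit. Unset Printing Implicit Defensive.

Inductive move := MoveL | MoveR | Stay.

Record TM := {
  tm_Q : finType;
  tm_G : finType;
  tm_blank : tm_G;
  tm_inp : bool -> tm_G;
  tm_start : tm_Q;
  tm_accept : tm_Q;
  tm_reject : tm_Q;
  tm_delta : tm_Q -> tm_G -> tm_Q * tm_G * move }.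

(* configuration: state, reversed tape left of head, head symbol, tape right of head *)
Record config (M : TM) := Config {
  cst : tm_Q M; cleft : seq (tm_G M); chead : tm_G M; cright : seq (tm_G M) }.

Definition tm_halted (M : TM) (c : config M) : bool :=
  (cst c == tm_accept M) || (cst c == tm_reject M).

Definition tm_step (M : TM) (c : config M) : config M :=
  if tm_halted c then c else
  let: (q', a, mv) := tm_delta (cst c) (chead c) in
  match mv with
  | Stay => Config q' (cleft c) a (cright c)
  | MoveL => match cleft c with
             | [::] => Config q' [::] (tm_blank M) (a :: cright c)
             | b :: l => Config q' l b (a :: cright c)
             end
  | MoveR => match cright c with
             | [::] => Config q' (a :: cleft c) (tm_blank M) [::]
             | b :: r => Config q' (a :: cleft c) b r
             end
  end.

Definition tm_init (M : TM) (w : seq bool) : config M :=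
  match w with
  | [::] => Config (tm_start M) [::] (tm_blank M) [::]
  | b :: w' => Config (tm_start M) [::] (tm_inp M b) (map (tm_inp M) w')
  end.

Definition tm_run (M : TM) (T : nat) (w : seq bool) : config M :=
  iter T (@tm_step M) (tm_init M w).

Definition tm_decides (M : TM) (L : seq bool -> Prop) : Prop :=
  forall w, exists T, tm_halted (tm_run M T w) /\
                      (cst (tm_run M T w) = tm_accept M <-> L w).

Definition computable_fun (f : nat -> nat) : Prop :=
  exists M : TM, tm_decides M
    (fun w => exists k m, w = nseq k true ++ false :: nseq m true /\ f k = m).

(* A directed graph on vertex set 'I_n is an edge relation E (loops allowed).
   A trail from s given by the successive vertices p (so of length size p)
   is a walk whose directed edges (consecutive pairs) are pairwise distinct. *)
Definition is_trail (n : nat) (E : rel 'I_n) (s t : 'I_n) (p : seq 'I_n) : bool :=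
  [&& path E s p, last s p == t & uniq (zip (s :: p) p)].

Definition trail_exact n (E : rel 'I_n) (s t : 'I_n) (k : nat) : Prop :=
  exists p, is_trail E s t p /\ size p = k.
Definition trail_atmost n (E : rel 'I_n) (s t : 'I_n) (k : nat) : Prop :=
  exists p, is_trail E s t p /\ size p <= k.
Definition trail_atleast n (E : rel 'I_n) (s t : 'I_n) (k : nat) : Prop :=
  exists p, is_trail E s t p /\ k <= size p.

Definition enc_instance (n : nat) (E : rel 'I_n) (s t : 'I_n) (k : nat) : seq bool :=
  nseq n true ++ false ::
  [seq E i j | i <- enum 'I_n, j <- enum 'I_n] ++
  nseq s true ++ false :: nseq t true ++ false :: nseq k true.

Definition trail_problem := forall n : nat, rel 'I_n -> 'I_n -> 'I_n -> nat -> Prop.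

Definition FPT (P : trail_problem) : Prop :=
  exists (M : TM) (f : nat -> nat) (c : nat),
    computable_fun f /\
    forall n (E : rel 'I_n) (s t : 'I_n) (k : nat),
      let w := enc_instance E s t k in
      let cf := tm_run M (f k * size w ^ c) w in
      tm_halted cf /\ (cst cf = tm_accept M <-> P n E s t k).

(* Main.v *)
Require Import Defs.
From mathcomp Require Import all_boot.
From mathcomp Require Import zify.
From Stdlib Require Import FunctionalExtensionality.
Set Implicit Arguments. Unset Strict Implicit. Unset Printing Implicit Defensive.

(** Trails of length i from s are summarised by a family R_i that is representative: whenever a
    trail of length i from s to v avoids a set X of at most Q - i edges, some member of R_i ending
    in v avoids X.  Extending the members of R_i by one edge and thinning out the result, which
    takes a search tree of depth Q and branching k, gives R_(i+1); with Q = 2k all families have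
    size at most n times a function of k.  A trail of length k to t exists iff R_k has a member
    ending in t, and length at most k is plain reachability.  A trail of length at least k exists
    iff some member of R_k can be continued to t along unused edges: in a shortest trail with at
    least k edges, replace the first k edges by a member of R_k avoiding the last k edges; if it
    met an edge in between, a shortcut would contradict minimality.

    The Turing machines come from a small language of total functions on binary trees, compiled
    through stack programs, whose stacks are tracks of the tape, and structured tape programs.
    Running times are polynomial in a measure of the input that adds to its size the branching
    bound (k+1)^(2k+1), which is the fixed-parameter form. *)

(** * Structured tape programs *)

(** The capacity [Q = 2k] is what length at least [k] requires: [k] units for the prefix that is
    built edge by edge, and [k] for the set [X] that must be avoided afterwards. The whole rest of a
    long trail cannot serve as [X], since its length is not bounded in [k]; only its last [k] edges
    can, and minimality has to take care of the middle. The number [k] is right for this tail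
    because a shortcut that enters the rest before the tail still retains [k] edges. For length at
    most [k] nothing has to be remembered, because a walk that repeats no vertex repeats no edge. On
    the machine side the obstacle is the explicit clock: running times must be derived through every
    layer down to single tape steps. Programs on trees therefore come with a cost function, and
    closure properties of polynomial bounds take the place of explicit estimates. *)

Section StructuredPrograms.
Variable G : finType.

(** A test sees only the scanned cell, so each test of a [While] is preceded by [pre], which brings
    the head to the cell to be inspected; [post] repositions the head on exit. *)
Inductive cmd :=
| Act of (G -> G * move)
| Seq of cmd & cmd
| If of pred G & cmd & cmd
| While of cmd & pred G & cmd & cmd.

Fixpoint state (c : cmd) : finType := match c with
  | Act _ => unit
  | Seq a b => (state a + state b)%type
  | If _ a b => option (state a + state b)%type
  | While pre _ body post => option (state pre + (state body + state post))%type
  end.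

Fixpoint entry (c : cmd) : state c := match c with
  | Act _ => tt
  | Seq a b => inl (entry a)
  | If _ a b => None
  | While pre _ body post => Some (inl (entry pre))
  end.

(** The next state [None] means that the command has finished; the enclosing command then decides
    where control goes. *)
Fixpoint trans (c : cmd) : state c -> G -> option (state c) * G * move :=
  match c with
  | Act g => fun _ x => (None, (g x).1, (g x).2)
  | Seq a b => fun q x => match q with
    | inl q => let: (o, y, m) := trans q x in (Some (oapp inl (inr (entry b)) o), y, m)
    | inr q => let: (o, y, m) := trans q x in (omap inr o, y, m)
    end
  | If p a b => fun q x => match q with
    | None => (Some (Some (if p x then inl (entry a) else inr (entry b))), x, Stay)
    | Some (inl q) => let: (o, y, m) := trans q x in (omap (fun q => Some (inl q)) o, y, m)
    | Some (inr q) => let: (o, y, m) := trans q x in (omap (fun q => Some (inr q)) o, y, m)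
    end
  | While pre p body post => fun q x => match q with
    | None => (Some (Some (inr (if p x then inl (entry body) else inr (entry post)))), x, Stay)
    | Some (inl q) => let: (o, y, m) := trans q x in
        (Some (omap inl o), y, m)
    | Some (inr (inl q)) => let: (o, y, m) := trans q x in
        (Some (Some (oapp (fun q => inr (inl q)) (inl (entry pre)) o)), y, m)
    | Some (inr (inr q)) => let: (o, y, m) := trans q x in
        (omap (fun q => Some (inr (inr q))) o, y, m)
    end
  end.

Definition tape := ((nat -> G) * nat)%type.

Definition upd (A : Type) (f : nat -> A) i a : nat -> A := fun j => if j == i then a else f j.

Definition move_pos (m : move) p := match m with MoveL => p.-1 | MoveR => p.+1 | Stay => p end.

(** Positions are absolute. A left move from position 0 would make the machine insert a cell and
    shift all positions, so it is excluded. *)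
Inductive exec : cmd -> tape -> tape -> nat -> Prop :=
| ExecAct g (T : nat -> G) p : ((g (T p)).2 = MoveL -> 0 < p) ->
    exec (Act g) (T, p) (upd T p (g (T p)).1, move_pos (g (T p)).2 p) 1
| ExecSeq a b t1 t2 t3 n1 n2 : exec a t1 t2 n1 -> exec b t2 t3 n2 ->
    exec (Seq a b) t1 t3 (n1 + n2)
| ExecIfT (p : pred G) a b t t' n : p (t.1 t.2) -> exec a t t' n -> exec (If p a b) t t' n.+1
| ExecIfF (p : pred G) a b t t' n : ~~ p (t.1 t.2) -> exec b t t' n -> exec (If p a b) t t' n.+1
| ExecWhileT (p : pred G) pre body post t1 t2 t3 t4 n1 n2 n3 : exec pre t1 t2 n1 -> p (t2.1 t2.2) ->
    exec body t2 t3 n2 -> exec (While pre p body post) t3 t4 n3 ->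
    exec (While pre p body post) t1 t4 (n1 + (n2 + n3).+1)
| ExecWhileF (p : pred G) pre body post t1 t2 t3 n1 n2 : exec pre t1 t2 n1 -> ~~ p (t2.1 t2.2) ->
    exec post t2 t3 n2 ->
    exec (While pre p body post) t1 t3 (n1 + n2.+1).

End StructuredPrograms.

(** * Structured programs inside a Turing machine *)

Section Embedding.
Variable M : TM.
Let G := tm_G M.

(** Position 0 is the leftmost cell present in the configuration. The default value of [nth]
    identifies the finite tape with one that is blank further to the right. *)
Definition represents (cf : config M) (t : tape G) : Prop :=
  size (cleft cf) = t.2 /\
  forall i, nth (tm_blank M) (rev (cleft cf) ++ chead cf :: cright cf) i = t.1 i.

Lemma represents_head cf t : represents cf t -> chead cf = t.1 t.2.
Proof. by case=> <- <-; rewrite nth_cat size_rev ltnn subnn. Qed.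

Lemma represents_step (cf : config M) (T : nat -> G) p q a mv : represents cf (T, p) -> ~~ tm_halted cf ->
  tm_delta (cst cf) (T p) = (q, a, mv) -> (mv = MoveL -> 0 < p) ->
  cst (tm_step cf) = q /\ represents (tm_step cf) (upd T p a, move_pos mv p).
Proof.
move=> R /negbTE nh Hd Hp; rewrite /tm_step nh (represents_head R) /= Hd.
case: cf R {nh Hd} => st l h r [/= sl Hn].
case: mv Hp => Hp.
- case: l sl Hn => [|b l] sl Hn; first by move: (Hp erefl); rewrite -sl.
  split=> //; split => /=; first by rewrite -sl.
  move=> i; rewrite /upd -Hn -sl rev_cons -cats1 -catA /= !nth_cat !size_rev /=.
  case: ltnP => Hi; first by case: eqP => //; lia.
  by case E: (i - size l) => [|[|j]] //=; case: eqP => //; lia.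
- case: r Hn => [|b r] Hn; split=> //; split; rewrite /= ?sl // => i;
    rewrite /upd -Hn -sl rev_cons -cats1 -catA /= !nth_cat !size_rev /=;
    (case: ltnP => Hi; first by case: eqP => //; lia);
    by case E: (i - size l) => [|[|j]] //=; rewrite ?nth_nil; case: eqP => //; lia.
- split=> //; split=> //= i; rewrite /upd -Hn -sl !nth_cat !size_rev.
  case: ltnP => Hi; first by case: eqP => //; lia.
  by case E: (i - size l) => [|j] //=; case: eqP => //; lia.
Qed.

(** Control leaves [c] through the single state [e]. The images of states avoid the halting states,
    in which [tm_step] would freeze. *)
Definition embeds (c : cmd G) (i : state c -> tm_Q M) (e : tm_Q M) : Prop :=
  (forall q, i q != tm_accept M /\ i q != tm_reject M) /\
  forall q x, tm_delta (i q) x = let: (o, y, m) := trans q x in (oapp i e o, y, m).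

(** A subcommand runs under [i] composed with the injection of its states, its exit being the entry
    of whatever comes next; for the body of a loop this is the entry of [pre]. *)
Lemma exec_run (c : cmd G) t t' n : exec c t t' n -> forall i e, @embeds c i e ->
  forall cf, cst cf = i (entry c) -> represents cf t ->
  cst (iter n (@tm_step M) cf) = e /\ represents (iter n (@tm_step M) cf) t'.
Proof.
have nohalt (d : cmd G) (i : state d -> tm_Q M) e cf q : embeds i e -> cst cf = i q -> ~~ tm_halted cf.
  by move=> [H _] E; rewrite /tm_halted E negb_or; apply/andP; exact: H.
have stay (d : cmd G) (i : state d -> tm_Q M) e cf s q q' : embeds i e -> cst cf = i q -> represents cf s ->
    trans q (s.1 s.2) = (q', s.1 s.2, Stay) ->
    cst (tm_step cf) = oapp i e q' /\ represents (tm_step cf) s.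
  move=> He Hq R Ht; case: s R Ht => T p R /= Ht.
  have [|//|-> R'] := @represents_step cf T p (oapp i e q') (T p) Stay R (nohalt _ _ _ _ _ He Hq).
    by rewrite Hq He.2 Ht.
  split=> //; suff -> : T = upd T p (T p) by [].
  by apply: functional_extensionality => j; rewrite /upd; case: eqP => [->|].
have add_iter m n' (cf : config M) : iter (m + n') (@tm_step M) cf = iter n' (@tm_step M) (iter m (@tm_step M) cf).
  by rewrite addnC iterD.
elim=> {c t t' n}.
- move=> g T p Hp i e He cf Hq R; apply: (represents_step R) => //.
    exact: nohalt He Hq.
  by rewrite Hq He.2.
- move=> a b t1 t2 t3 n1 n2 _ IH1 _ IH2 i e [He1 He2] cf Hq R; rewrite add_iter.
  have [|h1 h2] := IH1 (i \o inl) (i (inr (entry b))) _ cf Hq R.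
    by split=> [q|q x] /=; [exact: He1|rewrite He2 /=; case: trans => [[[o|] y] m]].
  apply: (IH2 (i \o inr) e _ _ h1 h2).
  by split=> [q|q x] /=; [exact: He1|rewrite He2 /=; case: trans => [[[o|] y] m]].
- move=> p a b t t' n Hp _ IH i e He cf Hq R; rewrite iterSr.
  have [|h1 h2] := stay _ i e cf t None (Some (Some (inl (entry a)))) He Hq R.
    by rewrite /= Hp.
  apply: (IH (fun q => i (Some (inl q))) e _ _ h1 h2).
  by split=> [q|q x] /=; [exact: He.1|rewrite He.2 /=; case: trans => [[[o|] y] m]].
- move=> p a b t t' n Hp _ IH i e He cf Hq R; rewrite iterSr.
  have [|h1 h2] := stay _ i e cf t None (Some (Some (inr (entry b)))) He Hq R.
    by rewrite /= (negbTE Hp).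
  apply: (IH (fun q => i (Some (inr q))) e _ _ h1 h2).
  by split=> [q|q x] /=; [exact: He.1|rewrite He.2 /=; case: trans => [[[o|] y] m]].
- move=> p pre body post t1 t2 t3 t4 n1 n2 n3 _ IH1 Hp _ IH2 _ IH3 i e He cf Hq R.
  rewrite add_iter iterSr.
  have [|h1 h2] := IH1 (fun q => i (Some (inl q))) (i None) _ cf Hq R.
    by split=> [q|q x] /=; [exact: He.1|rewrite He.2 /=; case: trans => [[[o|] y] m]].
  have [|h3 h4] := stay _ i e _ t2 None (Some (Some (inr (inl (entry body))))) He h1 h2.
    by rewrite /= Hp.
  rewrite add_iter.
  have [|h5 h6] := IH2 (fun q => i (Some (inr (inl q)))) (i (Some (inl (entry pre)))) _ _ h3 h4.
    by split=> [q|q x] /=; [exact: He.1|rewrite He.2 /=; case: trans => [[[o|] y] m]].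
  exact: (IH3 i e He _ h5 h6).
- move=> p pre body post t1 t2 t3 n1 n2 _ IH1 Hp _ IH2 i e He cf Hq R.
  rewrite add_iter iterSr.
  have [|h1 h2] := IH1 (fun q => i (Some (inl q))) (i None) _ cf Hq R.
    by split=> [q|q x] /=; [exact: He.1|rewrite He.2 /=; case: trans => [[[o|] y] m]].
  have [|h3 h4] := stay _ i e _ t2 None (Some (Some (inr (inr (entry post))))) He h1 h2.
    by rewrite /= (negbTE Hp).
  apply: (IH2 (fun q => i (Some (inr (inr q)))) e _ _ h3 h4).
  by split=> [q|q x] /=; [exact: He.1|rewrite He.2 /=; case: trans => [[[o|] y] m]].
Qed.

End Embedding.

(** * Stack programs *)

Inductive scmd :=
| SSkip
| SPush of nat & bool
| SPop of nat
| SSeq of scmd & scmd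
| SIf of pred (option bool) & nat & scmd & scmd
| SWhile of pred (option bool) & nat & scmd.

Definition store := nat -> seq bool.

Inductive sexec : scmd -> store -> store -> nat -> Prop :=
| XSkip S : sexec SSkip S S 1
| XPush i b S : sexec (SPush i b) S (upd S i (b :: S i)) 1
| XPop i S : sexec (SPop i) S (upd S i (behead (S i))) 1
| XSeq a b S1 S2 S3 n1 n2 : sexec a S1 S2 n1 -> sexec b S2 S3 n2 -> sexec (SSeq a b) S1 S3 (n1 + n2)
| XIfT (p : pred (option bool)) i a b S S' n : p (ohead (S i)) -> sexec a S S' n -> sexec (SIf p i a b) S S' n.+1
| XIfF (p : pred (option bool)) i a b S S' n : ~~ p (ohead (S i)) -> sexec b S S' n -> sexec (SIf p i a b) S S' n.+1
| XWhileT (p : pred (option bool)) i a S1 S2 S3 n1 n2 : p (ohead (S1 i)) -> sexec a S1 S2 n1 ->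
    sexec (SWhile p i a) S2 S3 n2 -> sexec (SWhile p i a) S1 S3 (n1 + n2).+1
| XWhileF (p : pred (option bool)) i a S : ~~ p (ohead (S i)) -> sexec (SWhile p i a) S S 1.

Fixpoint max_index (c : scmd) : nat := match c with
  | SSkip => 0
  | SPush i _ | SPop i => i
  | SSeq a b => maxn (max_index a) (max_index b)
  | SIf _ i a b => maxn i (maxn (max_index a) (max_index b))
  | SWhile _ i a => maxn i (max_index a)
  end.

(** * Stacks as tracks of one tape *)

Section Tracks.
Variable r : nat.

(* [None] marks the left end of the tape; stack [i] is written bottom-first on track [i]
   of the cells that follow, so that its top is the last nonblank cell of the track. *)
Definition cell : finType := option {ffun 'I_r.+1 -> option bool}.

Definition tape_of (S : store) : nat -> cell := fun p =>
  if p is p'.+1 then Some [ffun j : 'I_r.+1 => nth None (map Some (rev (S j))) p'] else None.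

Definition read i (g : cell) : option bool := if g is Some t then t (inord i) else None.
Definition write i b (g : cell) : cell :=
  if g is Some t then Some [ffun j => if j == inord i then b else t j] else None.

Definition stay : cmd cell := Act (fun g => (g, Stay)).
Definition go_left : cmd cell := Act (fun g => (g, MoveL)).
Definition go_right : cmd cell := Act (fun g => (g, MoveR)).
Definition put i b : cmd cell := Act (fun g => (write i b g, Stay)).
Definition home : cmd cell := While stay isSome go_left stay.
(** Stops on the top of the stack, or on the end marker if the stack is empty; [read] yields [None]
    there, in agreement with [ohead]. *)
Definition seek i : cmd cell :=
  Seq go_right (Seq (While stay (fun g => isSome (read i g)) go_right stay) go_left).

(** Between stack commands the head rests on the end marker, so every access is a trip to the top of
    one track and back. *)
Fixpoint on_tracks (c : scmd) : cmd cell := match c with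
  | SSkip => stay
  | SPush i b => Seq (seek i) (Seq go_right (Seq (put i (Some b)) home))
  | SPop i => Seq (seek i) (Seq (put i None) home)
  | SSeq a b => Seq (on_tracks a) (on_tracks b)
  | SIf p i a b => Seq (seek i)
      (If (p \o read i) (Seq home (on_tracks a)) (Seq home (on_tracks b)))
  | SWhile p i a => While (seek i) (p \o read i) (Seq home (on_tracks a)) home
  end.

Lemma upd_id (A : Type) (f : nat -> A) i : upd f i (f i) = f.
Proof. by apply: functional_extensionality => j; rewrite /upd; case: eqP => [->|]. Qed.

Definition within (c : cmd cell) t t' n := exists2 m, m <= n & exec c t t' m.

Lemma within_seq a b t1 t2 t3 n1 n2 n : within a t1 t2 n1 -> within b t2 t3 n2 -> n1 + n2 <= n ->
  within (Seq a b) t1 t3 n.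
Proof. by case=> m1 l1 e1 [m2 l2 e2] le; exists (m1 + m2); [lia | exact: ExecSeq e1 e2]. Qed.

Lemma within_if (p : pred cell) a b (t t' : tape cell) n n' :
  within (if p (t.1 t.2) then a else b) t t' n' -> n' < n -> within (If p a b) t t' n.
Proof.
case=> m; case: ifP => Hp le e len; exists m.+1; try lia; first exact: ExecIfT.
by apply: ExecIfF => //; rewrite Hp.
Qed.

Lemma within_whileT (p : pred cell) pre body post (t1 t2 t3 t4 : tape cell) n1 n2 n3 n : within pre t1 t2 n1 ->
  p (t2.1 t2.2) -> within body t2 t3 n2 -> within (While pre p body post) t3 t4 n3 ->
  n1 + n2 + n3 < n -> within (While pre p body post) t1 t4 n.
Proof.
case=> m1 l1 e1 Hp [m2 l2 e2] [m3 l3 e3] le.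
by exists (m1 + (m2 + m3).+1); [lia | exact: ExecWhileT e1 Hp e2 e3].
Qed.

Lemma within_whileF (p : pred cell) pre body post (t1 t2 t3 : tape cell) n1 n2 n : within pre t1 t2 n1 ->
  ~~ p (t2.1 t2.2) -> within post t2 t3 n2 ->
  n1 + n2 < n -> within (While pre p body post) t1 t3 n.
Proof.
case=> m1 l1 e1 Hp [m2 l2 e2] le.
by exists (m1 + m2.+1); [lia | exact: ExecWhileF e1 Hp e2].
Qed.

Lemma within_stay T p : within stay (T, p) (T, p) 1.
Proof. by exists 1 => //; have := @ExecAct cell (fun g => (g, Stay)) T p; rewrite /= upd_id; apply. Qed.

Lemma within_right T p : within go_right (T, p) (T, p.+1) 1.
Proof. by exists 1 => //; have := @ExecAct cell (fun g => (g, MoveR)) T p; rewrite /= upd_id; apply. Qed.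

Lemma within_left T p : within go_left (T, p.+1) (T, p) 1.
Proof. by exists 1 => //; have := @ExecAct cell (fun g => (g, MoveL)) T p.+1; rewrite /= upd_id; apply. Qed.

Lemma within_home S p : within home (tape_of S, p) (tape_of S, 0) (3 * p + 3).
Proof.
elim: p => [|p IH]; first by apply: (within_whileF _ (within_stay _ _) _ (within_stay _ _)).
by apply: (within_whileT (within_stay _ _) _ (within_left _ _) IH) => //; lia.
Qed.

Lemma read_tape_of S i p : i <= r -> read i (tape_of S p.+1) = nth None (map Some (rev (S i))) p.
Proof. by move=> le; rewrite /= ffunE inordK. Qed.

Lemma read_top S i : i <= r -> read i (tape_of S (size (S i))) = ohead (S i).
Proof.
case E: (S i) => [|b s] //= le; rewrite -[size s]/(size (b :: s)).-1 -{1}E.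
by rewrite ffunE inordK // E rev_cons map_rcons nth_rcons !size_map size_rev ltnn eqxx.
Qed.

Lemma within_seek S i : i <= r -> within (seek i) (tape_of S, 0) (tape_of S, size (S i)) (3 * size (S i) + 8).
Proof.
move=> le; pose loop := While stay (fun g : cell => isSome (read i g)) go_right stay.
suff H d p : p + d = size (S i) ->
    within loop (tape_of S, p.+1) (tape_of S, (size (S i)).+1) (3 * d + 3).
  apply: within_seq (within_right _ _) (within_seq (H (size (S i)) 0 _) (within_left _ _) (leqnn _)) _ => //.
  by lia.
elim: d p => [|d IH] p Hd.
  rewrite -Hd addn0; apply: (within_whileF _ (within_stay _ _) _ (within_stay _ _)); last by lia.
  by rewrite read_tape_of // nth_default // size_map size_rev -Hd addn0.
apply: (within_whileT (within_stay _ _) _ (within_right _ _) (IH p.+1 _)); try lia.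
rewrite read_tape_of // (nth_map false) // size_rev; lia.
Qed.

(** Serves both push and pop: with the bottom written first, either one alters a single cell of its
    track. *)
Lemma upd_tape_of S i b p s : i <= r -> nth None (map Some (rev s)) p = b ->
  (forall p', p' != p -> nth None (map Some (rev s)) p' = nth None (map Some (rev (S i))) p') ->
  upd (tape_of S) p.+1 (write i b (tape_of S p.+1)) = tape_of (upd S i s).
Proof.
move=> le Hb Hs; apply: functional_extensionality => -[|q]; rewrite /upd //= eqSS.
case: (q =P p) => [->|/eqP ne]; congr Some; apply/ffunP => j; rewrite !ffunE.
  have -> : (j == inord i) = (j == i :> nat) by rewrite -val_eqE /= inordK.
  by case: eqP.
by case: eqP => // ->; rewrite Hs.
Qed.

Lemma within_put T p i b : within (put i b) (T, p) (upd T p (write i b (T p)), p) 1.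
Proof. by exists 1 => //; have := @ExecAct cell (fun g => (write i b g, Stay)) T p; rewrite /=; apply. Qed.

Lemma sexec_sizes c S S' n D : sexec c S S' n -> (forall i, size (S i) <= D) ->
  forall i, size (S' i) <= D + n.
Proof.
move=> X; elim: X D => {c S S' n}.
- by move=> S D H i; apply: leq_trans (H i) (leq_addr _ _).
- move=> i b S D H j; rewrite /upd; case: eqP => _ /=; [have := H i | have := H j]; lia.
- move=> i S D H j; rewrite /upd; case: eqP => _; rewrite ?size_behead; [have := H i | have := H j]; lia.
- by move=> a b S1 S2 S3 n1 n2 _ IH1 _ IH2 D H i; rewrite addnA; apply: IH2; exact: IH1.
- by move=> p i a b S S' n _ _ IH D H j; rewrite addnS; apply: leqW; exact: IH.
- by move=> p i a b S S' n _ _ IH D H j; rewrite addnS; apply: leqW; exact: IH.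
- by move=> p i a S1 S2 S3 n1 n2 _ _ IH1 _ IH2 D H j; rewrite addnS addnA; apply: leqW; apply: IH2; exact: IH1.
- by move=> p i a S _ D H j; rewrite addn1; apply: leqW.
Qed.

(** A stack step pushes at most one symbol, so [L] bounds all stack heights during the run, and one
    step costs at most a trip out and back, within [6 * L + 20] moves. *)
Lemma on_tracks_correct c S S' n D L : sexec c S S' n -> max_index c <= r ->
  (forall i, size (S i) <= D) -> D + n <= L ->
  within (on_tracks c) (tape_of S, 0) (tape_of S', 0) (n * (6 * L + 20)).
Proof.
pose K := 6 * L + 20; rewrite -/K; have HK : K = 6 * L + 20 by []; clearbody K.
move=> X; elim: X D => {c S S' n} /=.
- by move=> S D _ _ _; have [m le e] := within_stay (tape_of S) 0; exists m => //; rewrite ?mulSn ?mulnDl; lia.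
- move=> i b S D le H HL; have Hi := H i.
  have := within_put (tape_of S) (size (S i)).+1 i (Some b).
  rewrite (@upd_tape_of S i (Some b) (size (S i)) (b :: S i)) //.
  + move=> W; apply: within_seq (within_seek _ le) (within_seq (within_right _ _)
      (within_seq W (within_home _ _) (leqnn _)) (leqnn _)) _.
    by rewrite ?mulSn ?mulnDl; lia.
  + by rewrite rev_cons map_rcons nth_rcons size_map size_rev ltnn eqxx.
  + move=> p ne; rewrite rev_cons map_rcons nth_rcons size_map size_rev (negbTE ne).
    by case: ltnP => // ge; rewrite nth_default // size_map size_rev.
- move=> i S D le H HL; have Hi := H i; have := within_put (tape_of S) (size (S i)) i None.
  suff -> : upd (tape_of S) (size (S i)) (write i None (tape_of S (size (S i)))) = tape_of (upd S i (behead (S i))).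
    move=> W; apply: within_seq (within_seek _ le) (within_seq W (within_home _ _) (leqnn _)) _.
    by rewrite ?mulSn ?mulnDl; lia.
  case E: (S i) => [|b s] /=; first by rewrite -E !upd_id.
  apply: upd_tape_of => //; first by rewrite nth_default // size_map size_rev.
  move=> p ne; rewrite E rev_cons map_rcons nth_rcons size_map size_rev (negbTE ne).
  by case: ltnP => // ge; rewrite nth_default // size_map size_rev.
- move=> a b S1 S2 S3 n1 n2 X1 IH1 _ IH2 D le H HL.
  apply: within_seq (IH1 D _ H _) (IH2 (D + n1) _ (sexec_sizes X1 H) _) _; lia.
- move=> p i a b S S' n Hp _ IH D le H HL; have Hi := H i.
  apply: (@within_seq _ _ _ _ _ _ (3 * size (S i) + 4 + n * K)  _ (within_seek _ _)); try lia.
    apply: (@within_if _ _ _ _ _ _ (3 * size (S i) + 3 + n * K)); last lia.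
    rewrite /= read_top ?Hp; last lia.
    apply: within_seq (within_home _ _) (IH D _ H _) _; lia.
- move=> p i a b S S' n Hp _ IH D le H HL; have Hi := H i.
  apply: (@within_seq _ _ _ _ _ _ (3 * size (S i) + 4 + n * K)  _ (within_seek _ _)); try lia.
    apply: (@within_if _ _ _ _ _ _ (3 * size (S i) + 3 + n * K)); last lia.
    rewrite /= read_top ?(negbTE Hp); last lia.
    apply: within_seq (within_home _ _) (IH D _ H _) _; lia.
- move=> p i a S1 S2 S3 n1 n2 Hp X1 IH1 _ IH2 D le H HL; have Hi := H i.
  apply: (within_whileT (within_seek _ _) _ (within_seq (within_home _ _) (IH1 D _ H _) (leqnn _)) (IH2 (D + n1) _ (sexec_sizes X1 H) _)); try lia.
  by rewrite /= read_top //; lia.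
- move=> p i a S Hp D le H HL; have Hi := H i.
  apply: (within_whileF _ (within_seek _ _) _ (within_home _ _)); try lia.
  by rewrite /= read_top //; lia.
Qed.

End Tracks.

(** * The Turing machine of a stack program *)

Section StackMachine.
Variable c : scmd.
Let r := max_index c.
Let prog : cmd (cell r) := Seq (on_tracks r c) (seek r 0).

Let Q : finType := (bool + (state prog + option bool))%type.

(** The two starting states move to the left of the input and write the end marker there, after
    which the input already forms track 0. The state [inr (inr None)] gives the verdict from the top
    of stack 0, where [seek] has left the head. *)
Let delta (q : Q) (x : cell r) : Q * cell r * move := match q with
  | inl false => (inl true, x, MoveL)
  | inl true => (inr (inl (entry prog)), None, Stay)
  | inr (inl q) => let: (o, y, m) := trans q x in
      (oapp (fun q => inr (inl q)) (inr (inr None)) o, y, m)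
  | inr (inr None) => (inr (inr (Some (read 0 x == Some true))), x, Stay)
  | inr (inr (Some b)) => (q, x, Stay)
  end.

Definition stack_machine : TM := {|
  tm_blank := (Some [ffun => None] : cell r);
  tm_inp b := Some [ffun j => if j == ord0 then Some b else None];
  tm_start := (inl false : Q);
  tm_accept := (inr (inr (Some true)) : Q);
  tm_reject := (inr (inr (Some false)) : Q);
  tm_delta := delta |}.

(** The word is written from left to right and stacks from the bottom, so the last bit is on top. *)
Definition input_store (w : seq bool) : store := fun j => if j == 0 then rev w else [::].

Lemma tm_halted_iter (M : TM) (cf : config M) m n : m <= n -> tm_halted (iter m (@tm_step M) cf) ->
  iter n (@tm_step M) cf = iter m (@tm_step M) cf.
Proof.
move=> le H; rewrite -(subnK le) iterD; elim: (n - m) => [|d IH] //=.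
by rewrite IH /tm_step H.
Qed.

(** Beyond the program itself the time pays for the last [seek], at most [3 * (size w + n) + 8], two
    starting steps and the verdict. Halted configurations are fixed, so any later [T] will do. *)
Lemma stack_machine_correct w S n T : sexec c (input_store w) S n ->
  n * (6 * (size w + n) + 20) + 3 * (size w + n) + 11 <= T ->
  let cf := tm_run stack_machine T w in
  tm_halted cf /\ (cst cf = tm_accept stack_machine <-> ohead (S 0) = Some true).
Proof.
move=> X leT; pose M := stack_machine.
have Hs i : size (input_store w i) <= size w by rewrite /input_store; case: eqP; rewrite ?size_rev.
have [m1 le1 e1] := on_tracks_correct X (leqnn _) Hs (leqnn _).
have [m2 le2 e2] := @within_seek r S 0 isT; rewrite -/r in e1 e2.
have e := ExecSeq e1 e2; set m := m1 + m2 in e.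
have emb : @embeds M prog (fun q => inr (inl q)) (inr (inr None)) by split.
have sz0 := sexec_sizes X Hs 0.
pose boot := iter 2 (@tm_step M) (tm_init M w).
have [b1 b2] : cst boot = inr (inl (entry prog)) /\ represents boot (tape_of r (input_store w), 0).
  split; first by rewrite /boot; case: (w).
  have Tw j : tape_of r (input_store w) j = nth (Some [ffun => None]) (None :: map (@tm_inp M) w) j.
    case: j => [|j] //=; case: (ltnP j (size w)) => Hj.
      rewrite (nth_map false) //; congr Some; apply/ffunP => i; rewrite !ffunE /input_store.
      have -> : (i == ord0) = (i == 0 :> nat) by rewrite -val_eqE.
      by case: eqP; rewrite ?nth_nil // revK (nth_map false).
    rewrite nth_default ?size_map //; congr Some; apply/ffunP => i; rewrite !ffunE nth_default //.
    by rewrite /input_store size_map; case: eqP; rewrite ?size_rev.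
  rewrite /boot; case: (w) Tw => [|b w'] Tw; split=> //= j; rewrite Tw //.
  by case: j => [|[|j]] //=; rewrite nth_nil.
have [c1 c2] := @exec_run M prog _ _ m e _ _ emb boot b1 b2.
have run : tm_run M (2 + m + 1) w = tm_step (iter m (@tm_step M) boot).
  by rewrite /tm_run -addnA addnC iterD addnC iterD.
set cf := iter m _ _ in c1 c2 run.
have fin : cst (tm_run M (2 + m + 1) w) = inr (inr (Some (ohead (S 0) == Some true))).
  have nh : ~~ tm_halted cf by rewrite /tm_halted c1.
  have D : tm_delta (cst cf) (tape_of r S (size (S 0))) =
      (inr (inr (Some (ohead (S 0) == Some true))), tape_of r S (size (S 0)), Stay).
    by rewrite c1 /= read_top.
  by rewrite run; case: (represents_step c2 nh D).
have hal : tm_halted (tm_run M (2 + m + 1) w).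
  by rewrite /tm_halted fin; case: (ohead (S 0) == Some true); rewrite eqxx ?orbT.
have -> : tm_run stack_machine T w = tm_run M (2 + m + 1) w.
  by apply: tm_halted_iter => //; move: leT le1 le2 sz0; rewrite /m; set a := n * _; lia.
split=> //; rewrite fin; split=> [[/eqP]|->] //.
Qed.

End StackMachine.

(** * Programs on binary trees *)

Inductive tree := Leaf | Node of tree & tree.

(** A prefix code: a counter finds the end of a tree, so concatenated codes need no separators. *)
Fixpoint str (t : tree) : seq bool :=
  if t is Node a b then true :: str a ++ str b else [:: false].

Definition tsz t := size (str t).

(** [Iter] is the only loop, and the right spine of its first argument fixes the number of rounds in
    advance, so every program is total. Lists and unary numbers have their length as spine. *)
Inductive fn :=
| Id
| Nil
| Car
| Cdr
| Cons of fn & fn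
| Comp of fn & fn
| Cond of fn & fn & fn
| Iter of fn.

Fixpoint titer (F : tree -> tree) (c y : tree) : tree :=
  if c is Node _ c' then titer F c' (F y) else y.

(** The term [10 * tsz a] pays for reading and discarding the label [a] in one round. *)
Fixpoint titer_cost (F : tree -> tree) (C : tree -> nat) (c y : tree) : nat :=
  if c is Node a c' then C y + 10 * tsz a + titer_cost F C c' (F y) else 0.

Fixpoint feval (p : fn) (x : tree) : tree := match p with
  | Id => x
  | Nil => Leaf
  | Car => if x is Node a _ then a else Leaf
  | Cdr => if x is Node _ b then b else Leaf
  | Cons f g => Node (feval f x) (feval g x)
  | Comp g f => feval g (feval f x)
  | Cond c f g => if feval c x is Node _ _ then feval f x else feval g x
  | Iter f => if x is Node c y then titer (feval f) c y else Leaf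
  end.

Fixpoint fcost (p : fn) (x : tree) : nat := match p with
  | Id => 1
  | Nil => 4 * tsz x
  | Car | Cdr => 20 * tsz x
  | Cons f g => fcost f x + fcost g x + 30 * (tsz x + tsz (feval f x) + tsz (feval g x))
  | Comp g f => fcost f x + fcost g (feval f x)
  | Cond c f g => fcost c x + 20 * (tsz x + tsz (feval c x)) +
      (if feval c x is Node _ _ then fcost f x else fcost g x)
  | Iter f => 30 * tsz x + (if x is Node c y then
      titer_cost (feval f) (fcost f) c y + 30 * tsz (titer (feval f) c y) else 0)
  end.

Lemma tsz_gt0 t : 0 < tsz t. Proof. by case: t. Qed.
Lemma tsz_node a b : tsz (Node a b) = (tsz a + tsz b).+1.
Proof. by rewrite /tsz /= size_cat. Qed.

Definition swithin c S S' n := exists2 m, m <= n & sexec c S S' m.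

Lemma swithin_le c S S' n n' : swithin c S S' n -> n <= n' -> swithin c S S' n'.
Proof. by case=> m le e le'; exists m => //; lia. Qed.

Lemma swithin_seq a b S1 S2 S3 n1 n2 : swithin a S1 S2 n1 -> swithin b S2 S3 n2 ->
  swithin (SSeq a b) S1 S3 (n1 + n2).
Proof. by case=> m1 l1 e1 [m2 l2 e2]; exists (m1 + m2); [lia | exact: XSeq e1 e2]. Qed.

Lemma swithin_if (p : pred (option bool)) i a b S S' n :
  swithin (if p (ohead (S i)) then a else b) S S' n -> swithin (SIf p i a b) S S' n.+1.
Proof.
case=> m; case: ifP => Hp le e; exists m.+1; try lia; first exact: XIfT.
by apply: XIfF => //; rewrite Hp.
Qed.

Lemma swithin_whileT (p : pred (option bool)) i a S1 S2 S3 n1 n2 : p (ohead (S1 i)) ->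
  swithin a S1 S2 n1 -> swithin (SWhile p i a) S2 S3 n2 -> swithin (SWhile p i a) S1 S3 (n1 + n2).+1.
Proof. by move=> Hp [m1 l1 e1] [m2 l2 e2]; exists (m1 + m2).+1; [lia | exact: XWhileT e1 e2]. Qed.

Lemma swithin_whileF (p : pred (option bool)) i a S : ~~ p (ohead (S i)) -> swithin (SWhile p i a) S S 1.
Proof. by exists 1 => //; exact: XWhileF. Qed.

Lemma swithin_push i b S : swithin (SPush i b) S (upd S i (b :: S i)) 1.
Proof. by exists 1 => //; constructor. Qed.

Lemma swithin_pop i S : swithin (SPop i) S (upd S i (behead (S i))) 1.
Proof. by exists 1 => //; constructor. Qed.

Lemma swithin_skip S : swithin SSkip S S 1.
Proof. by exists 1 => //; constructor. Qed.

Definition top_true : pred (option bool) := fun o => o == Some true.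

Definition clear i := SWhile isSome i (SPop i).

(* The order of the symbols is reversed, so moves come in pairs. *)
Definition mv i j := SWhile isSome i (SIf top_true i
  (SSeq (SPop i) (SPush j true)) (SSeq (SPop i) (SPush j false))).

Definition mv2 i j k := SWhile isSome i (SIf top_true i
  (SSeq (SPop i) (SSeq (SPush j true) (SPush k true)))
  (SSeq (SPop i) (SSeq (SPush j false) (SPush k false)))).

(* Reads one tree off stack [i]: the unary counter [k] holds the number of subtrees still due. *)
Definition scan_loop i k j := SWhile isSome k (SIf top_true i
  (SSeq (SPop i) (SSeq (SPush k true) (SPush j true)))
  (SSeq (SPop i) (SSeq (SPop k) (SPush j false)))).
Definition scan i k j := SSeq (SPush k true) (scan_loop i k j).

Lemma upd_upd (A : Type) (f : nat -> A) i a b : upd (upd f i a) i b = upd f i b.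
Proof. by apply: functional_extensionality => j; rewrite /upd; case: eqP. Qed.

Lemma updC (A : Type) (f : nat -> A) i j a b : i != j -> upd (upd f i a) j b = upd (upd f j b) i a.
Proof.
move=> /eqP ne; apply: functional_extensionality => k; rewrite /upd.
by case: eqP => // ->; case: eqP => // e; case: ne.
Qed.

Lemma upd_same (A : Type) (f : nat -> A) i a : upd f i a i = a.
Proof. by rewrite /upd eqxx. Qed.

Lemma upd_other (A : Type) (f : nat -> A) i j a : i != j -> upd f i a j = f j.
Proof. by rewrite /upd eq_sym => /negbTE ->. Qed.

Lemma swithin_clear S i : swithin (clear i) S (upd S i [::]) (2 * size (S i) + 1).
Proof.
move E: (S i) => s; elim: s S E => [|b s IH] S E.
  by rewrite -{1}E upd_id; apply: swithin_whileF; rewrite E.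
have := IH (upd S i (behead (S i))); rewrite upd_same upd_upd E => /(_ erefl) H.
apply: swithin_le (swithin_whileT _ (swithin_pop _ _) _) _; rewrite ?E //; first exact: H.
by rewrite /=; lia.
Qed.

Lemma swithin_mv S i j : i != j ->
  swithin (mv i j) S (upd (upd S i [::]) j (rev (S i) ++ S j)) (4 * size (S i) + 1).
Proof.
move=> ne; move E: (S i) => s; elim: s S E => [|b s IH] S E.
  have -> : upd S i [::] = S by rewrite -{1}E upd_id.
  by rewrite upd_id; apply: swithin_whileF; rewrite E.
have := IH (upd (upd S i s) j (b :: S j)).
rewrite upd_other 1?eq_sym // !upd_same => /(_ erefl).
rewrite (@updC _ _ j i) 1?eq_sym // !upd_upd => H.
have -> : rev (b :: s) ++ S j = rev s ++ b :: S j by rewrite rev_cons cat_rcons.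
apply: swithin_le (swithin_whileT (n1 := 3) _ _ H) _; last by rewrite /=; lia.
  by rewrite E.
apply: swithin_if; have Hb : swithin (SSeq (SPop i) (SPush j b)) S (upd (upd S i s) j (b :: S j)) 2.
  have := swithin_seq (swithin_pop i S) (swithin_push j b _); by rewrite E /= (upd_other _ _ ne).
by rewrite E; case: b Hb {H E}.
Qed.

Lemma swithin_mv2 S i j k : i != j -> i != k -> j != k ->
  swithin (mv2 i j k) S (upd (upd (upd S i [::]) j (rev (S i) ++ S j)) k (rev (S i) ++ S k))
    (5 * size (S i) + 1).
Proof.
move=> ij ik jk; move E: (S i) => s; elim: s S E => [|b s IH] S E.
  have -> : upd S i [::] = S by rewrite -{1}E upd_id.
  by rewrite !upd_id; apply: swithin_whileF; rewrite E.
pose S' := upd (upd (upd S i s) j (b :: S j)) k (b :: S k).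
have := IH S'.
rewrite {1}/S' upd_other 1?eq_sym // upd_other 1?eq_sym // upd_same => /(_ erefl).
have -> : S' j = b :: S j by rewrite /S' upd_other 1?eq_sym // upd_same.
have -> : S' k = b :: S k by rewrite /S' upd_same.
have -> : upd S' i [::] = upd (upd (upd S i [::]) j (b :: S j)) k (b :: S k).
  by rewrite /S' (@updC _ _ k i) 1?eq_sym // (@updC _ _ j i) 1?eq_sym // upd_upd.
rewrite (@updC _ _ k j) 1?eq_sym // !upd_upd => H.
have revE (l : seq bool) : rev (b :: s) ++ l = rev s ++ b :: l by rewrite rev_cons cat_rcons.
rewrite !revE.
apply: swithin_le (swithin_whileT (n1 := 4) _ _ H) _; last by rewrite /=; lia.
  by rewrite E.
apply: swithin_if; have Hb : swithin (SSeq (SPop i) (SSeq (SPush j b) (SPush k b))) S S' 3.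
  have := swithin_seq (swithin_pop i S) (swithin_seq (swithin_push j b _) (swithin_push k b _)).
  by rewrite E /= upd_other // upd_other // upd_other.
by rewrite E; case: b @S' Hb {H E IH revE}.
Qed.

(** Stated for an arbitrary continuation [S'] of the same loop: after a subtree the loop does not
    exit but turns to the subtrees still due, so the two induction hypotheses chain only in this
    form. *)
Lemma swithin_scan_loop t i k j S S' s ks n : i != k -> i != j -> k != j ->
  S i = str t ++ s -> S k = true :: ks ->
  swithin (scan_loop i k j) (upd (upd (upd S i s) k ks) j (rev (str t) ++ S j)) S' n ->
  swithin (scan_loop i k j) S S' (n + 5 * tsz t).
Proof.
move=> ik ij kj; elim: t S s ks n => [|a IHa b IHb] S s ks n Ei Ek H.
  apply: swithin_le (swithin_whileT (n1 := 4) _ _ H) _; last by rewrite /tsz /=; lia.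
    by rewrite Ek.
  apply: swithin_if; rewrite Ei /=.
  have := swithin_seq (swithin_pop i S) (swithin_seq (swithin_pop k _) (swithin_push j false _)).
  by rewrite Ei upd_other // Ek upd_other // upd_other.
rewrite tsz_node.
(* Reading a [Node] replaces one subtree due by two. *)
pose S1 := upd (upd (upd S i (str a ++ str b ++ s)) k [:: true, true & ks]) j (true :: S j).
apply: swithin_le (swithin_whileT (S2 := S1) (n1 := 4) (n2 := (n + 5 * tsz b) + 5 * tsz a) _ _ _) _.
- by rewrite Ek.
- apply: swithin_if; rewrite Ei /=.
  have := swithin_seq (swithin_pop i S) (swithin_seq (swithin_push k true _) (swithin_push j true _)).
  by rewrite Ei upd_other // Ek upd_other // upd_other //= -catA.
- have S1i : S1 i = str a ++ str b ++ s by rewrite /S1 upd_other 1?eq_sym // upd_other 1?eq_sym // upd_same.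
  have S1k : S1 k = [:: true, true & ks] by rewrite /S1 upd_other 1?eq_sym // upd_same.
  apply: (IHa _ _ _ _ S1i S1k).
  set S2 := upd _ j _.
  have S2i : S2 i = str b ++ s by rewrite /S2 upd_other 1?eq_sym // upd_other 1?eq_sym // upd_same.
  have S2k : S2 k = true :: ks by rewrite /S2 upd_other 1?eq_sym // upd_same.
  apply: (IHb _ _ _ _ S2i S2k).
  suff -> : upd (upd (upd S2 i s) k ks) j (rev (str b) ++ S2 j) =
      upd (upd (upd S i s) k ks) j (rev (str (Node a b)) ++ S j) by [].
  rewrite /S2 /S1 !upd_same /= rev_cons rev_cat cat_rcons -catA.
  apply: functional_extensionality => l; rewrite /upd.
  by case: (l == j); case: (l == k); case: (l == i).
by rewrite /=; lia.
Qed.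

Lemma swithin_scan t i k j S s : i != k -> i != j -> k != j ->
  S i = str t ++ s -> S k = [::] ->
  swithin (scan i k j) S (upd (upd S i s) j (rev (str t) ++ S j)) (5 * tsz t + 2).
Proof.
move=> ik ij kj Ei Ek.
apply: swithin_le (swithin_seq (swithin_push _ _ _) (swithin_scan_loop (t := t) (s := s) ik ij kj _ _ _)) _.
- by rewrite upd_other // eq_sym.
- by rewrite upd_same.
- rewrite upd_other //; set S2 := upd _ j _.
  have -> : S2 = upd (upd S i s) j (rev (str t) ++ S j).
    rewrite /S2; apply: functional_extensionality => l; rewrite /upd Ek.
    by case: (l == j); case: (l =P k) => // ->; rewrite Ek; case: (k =P i) => // e; rewrite e eqxx in ik.
  apply: swithin_whileF; rewrite upd_other 1?eq_sym // upd_other // Ek //.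
by lia.
Qed.

Definition frame (B : store) m a b c d : store :=
  fun j => if j < m then B j else nth [::] [:: a; b; c; d] (j - m).

Section Frame.
Variables (B : store) (m : nat).

Lemma frame0 a b c d : frame B m a b c d m = a.
Proof. by rewrite /frame ltnn subnn. Qed.
Lemma frame1 a b c d : frame B m a b c d m.+1 = b.
Proof. by rewrite /frame ltnNge leqnSn /= subSn // subnn. Qed.
Lemma frame2 a b c d : frame B m a b c d m.+2 = c.
Proof. by rewrite /frame ltnNge leqW //= -addn2 addKn. Qed.
Lemma frame3 a b c d : frame B m a b c d m.+3 = d.
Proof. by rewrite /frame ltnNge !leqW //= -addn3 addKn. Qed.

Let upd_frame a b c d i x : i < 4 -> upd (frame B m a b c d) (m + i) x =
  let v := set_nth [::] [:: a; b; c; d] i x in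
  frame B m (nth [::] v 0) (nth [::] v 1) (nth [::] v 2) (nth [::] v 3).
Proof.
move=> i4; apply: functional_extensionality => j; rewrite /upd /frame.
case: ltnP => Hj; first by case: eqP => // e; lia.
have [k ->] : exists k, j = m + k by exists (j - m); lia.
by rewrite eqn_add2l addKn; case: i i4 => [|[|[|[|]]]] //; case: k => [|[|[|[|k]]]].
Qed.

Lemma upd_frame0 a b c d x : upd (frame B m a b c d) m x = frame B m x b c d.
Proof. by rewrite -{2}[m]addn0 upd_frame. Qed.
Lemma upd_frame1 a b c d x : upd (frame B m a b c d) m.+1 x = frame B m a x c d.
Proof. by rewrite -[m.+1]addn1 upd_frame. Qed.
Lemma upd_frame2 a b c d x : upd (frame B m a b c d) m.+2 x = frame B m a b x d.
Proof. by rewrite -[m.+2]addn2 upd_frame. Qed.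
Lemma upd_frame3 a b c d x : upd (frame B m a b c d) m.+3 x = frame B m a b c x.
Proof. by rewrite -[m.+3]addn3 upd_frame. Qed.

Definition frameE := (frame0, frame1, frame2, frame3, upd_frame0, upd_frame1, upd_frame2, upd_frame3).

(** Allows the recursive use of compiled code at a higher base: the stacks under its argument become
    part of the protected store. *)
Lemma frame_shift1 a b : frame B m a b [::] [::] = frame (frame B m a [::] [::] [::]) m.+1 b [::] [::] [::].
Proof.
apply: functional_extensionality => j; rewrite /frame.
case: (ltnP j m) => Hj; first by rewrite leqW.
have [k ->] : exists k, j = m + k by exists (j - m); lia.
rewrite addKn; case: k => [|k]; first by rewrite addn0 leqnn.
by rewrite ltnNge addnS ltnS leq_addr /= subSS addKn; case: k => [|[|[|[|k]]]] //=; rewrite ?nth_nil.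
Qed.

Lemma frame_shift2 a b c : frame B m a b c [::] = frame (frame B m a b [::] [::]) m.+2 c [::] [::] [::].
Proof.
apply: functional_extensionality => j; rewrite /frame.
case: (ltnP j m) => Hj; first by rewrite !leqW.
have [k ->] : exists k, j = m + k by exists (j - m); lia.
rewrite addKn; case: (ltnP (m + k) m.+2) => Hk.
  by case: k Hk => [|[|k]] //; lia.
case: k Hk => [|[|k]] Hk; try lia.
rewrite !addnS !subSS addKn; clear Hk; case: k => [|[|[|[|k]]]] //=; by rewrite ?nth_nil.
Qed.

End Frame.

(* The argument is the content of stack [m] and is replaced by the result; the stacks above [m]
   are empty before and after. *)
Fixpoint compile (p : fn) (m : nat) : scmd := match p with
  | Id => SSkip
  | Nil => SSeq (clear m) (SPush m false)
  | Car => SIf top_true m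
      (SSeq (SPop m) (SSeq (scan m m.+1 m.+2) (SSeq (clear m) (mv m.+2 m)))) SSkip
  | Cdr => SIf top_true m
      (SSeq (SPop m) (SSeq (scan m m.+1 m.+2) (clear m.+2))) SSkip
  | Cons f g =>
      SSeq (mv m m.+1) (SSeq (mv2 m.+1 m m.+2) (SSeq (compile f m.+2)
      (SSeq (mv m m.+3) (SSeq (mv m.+2 m.+1) (SSeq (mv m.+3 m.+2) (SSeq (compile g m.+2)
      (SSeq (mv m.+2 m.+3) (SSeq (mv m.+3 m) (SSeq (mv m.+1 m) (SPush m true))))))))))
  | Comp g f => SSeq (compile f m) (compile g m)
  | Cond c f g =>
      SSeq (mv m m.+1) (SSeq (mv2 m.+1 m m.+2) (SSeq (compile c m.+2)
      (SIf top_true m.+2 (SSeq (clear m.+2) (compile f m)) (SSeq (clear m.+2) (compile g m)))))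
  | Iter f => SIf top_true m
      (SSeq (SPop m) (SSeq (scan m m.+1 m.+2)
      (SSeq (mv m m.+3) (SSeq (mv m.+3 m.+1) (SSeq (mv m.+2 m)
      (SSeq (SWhile top_true m (SSeq (SPop m) (SSeq (scan m m.+2 m.+3) (SSeq (clear m.+3) (compile f m.+1)))))
      (SSeq (SPop m) (SSeq (mv m.+1 m.+2) (mv m.+2 m)))))))))
      SSkip
  end.

Lemma swithin_seq_le a b S1 S2 S3 n1 n : swithin a S1 S2 n1 -> swithin b S2 S3 (n - n1) -> n1 <= n ->
  swithin (SSeq a b) S1 S3 n.
Proof. by move=> h1 h2 le; apply: swithin_le (swithin_seq h1 h2) _; lia. Qed.

Section FrameMacros.
Variables (B : store) (m : nat).
Notation F := (frame B m).

Lemma swithin_clear_frame0 a b c d : swithin (clear m) (F a b c d) (F [::] b c d) (2 * size a + 1).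
Proof. by have := swithin_clear (F a b c d) m; rewrite !frameE. Qed.
Lemma swithin_clear_frame2 a b c d : swithin (clear m.+2) (F a b c d) (F a b [::] d) (2 * size c + 1).
Proof. by have := swithin_clear (F a b c d) m.+2; rewrite !frameE. Qed.
Lemma swithin_clear_frame3 a b c d : swithin (clear m.+3) (F a b c d) (F a b c [::]) (2 * size d + 1).
Proof. by have := swithin_clear (F a b c d) m.+3; rewrite !frameE. Qed.

Let ne01 : m != m.+1. Proof. by lia. Qed.
Let ne02 : m != m.+2. Proof. by lia. Qed.
Let ne03 : m != m.+3. Proof. by lia. Qed.
Let ne12 : m.+1 != m.+2. Proof. by lia. Qed.
Let ne23 : m.+2 != m.+3. Proof. by lia. Qed.

Lemma swithin_mv01 a c d : swithin (mv m m.+1) (F a [::] c d) (F [::] (rev a) c d) (4 * size a + 1).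
Proof. by have := swithin_mv (F a [::] c d) ne01; rewrite !frameE cats0. Qed.
Lemma swithin_mv03 a b c : swithin (mv m m.+3) (F a b c [::]) (F [::] b c (rev a)) (4 * size a + 1).
Proof. by have := swithin_mv (F a b c [::]) ne03; rewrite !frameE cats0. Qed.
Lemma swithin_mv10 a b c d : swithin (mv m.+1 m) (F a b c d) (F (rev b ++ a) [::] c d) (4 * size b + 1).
Proof. by have := @swithin_mv (F a b c d) m.+1 m; rewrite eq_sym !frameE; apply. Qed.
Lemma swithin_mv12 a b d : swithin (mv m.+1 m.+2) (F a b [::] d) (F a [::] (rev b) d) (4 * size b + 1).
Proof. by have := swithin_mv (F a b [::] d) ne12; rewrite !frameE cats0. Qed.
Lemma swithin_mv20 b c d : swithin (mv m.+2 m) (F [::] b c d) (F (rev c) b [::] d) (4 * size c + 1).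
Proof. by have := @swithin_mv (F [::] b c d) m.+2 m; rewrite eq_sym !frameE cats0; apply. Qed.
Lemma swithin_mv21 a c d : swithin (mv m.+2 m.+1) (F a [::] c d) (F a (rev c) [::] d) (4 * size c + 1).
Proof. by have := @swithin_mv (F a [::] c d) m.+2 m.+1; rewrite eq_sym !frameE cats0; apply. Qed.
Lemma swithin_mv23 a b c : swithin (mv m.+2 m.+3) (F a b c [::]) (F a b [::] (rev c)) (4 * size c + 1).
Proof. by have := swithin_mv (F a b c [::]) ne23; rewrite !frameE cats0. Qed.
Lemma swithin_mv30 b c d : swithin (mv m.+3 m) (F [::] b c d) (F (rev d) b c [::]) (4 * size d + 1).
Proof. by have := @swithin_mv (F [::] b c d) m.+3 m; rewrite eq_sym !frameE cats0; apply. Qed.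
Lemma swithin_mv31 a c d : swithin (mv m.+3 m.+1) (F a [::] c d) (F a (rev d) c [::]) (4 * size d + 1).
Proof. by have := @swithin_mv (F a [::] c d) m.+3 m.+1; rewrite eq_sym !frameE cats0; apply. Qed.
Lemma swithin_mv32 a b d : swithin (mv m.+3 m.+2) (F a b [::] d) (F a b (rev d) [::]) (4 * size d + 1).
Proof. by have := @swithin_mv (F a b [::] d) m.+3 m.+2; rewrite eq_sym !frameE cats0; apply. Qed.

Lemma swithin_mv2_102 b d : swithin (mv2 m.+1 m m.+2) (F [::] b [::] d) (F (rev b) [::] (rev b) d) (5 * size b + 1).
Proof.
by have := @swithin_mv2 (F [::] b [::] d) m.+1 m m.+2; rewrite (eq_sym m.+1 m) !frameE !cats0; apply.
Qed.

Lemma swithin_scan012 t s d :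
  swithin (scan m m.+1 m.+2) (F (str t ++ s) [::] [::] d) (F s [::] (rev (str t)) d) (5 * tsz t + 2).
Proof.
have := @swithin_scan t m m.+1 m.+2 (F (str t ++ s) [::] [::] d) s ne01 ne02 ne12.
by rewrite !frameE cats0; apply.
Qed.
Lemma swithin_scan023 t s b :
  swithin (scan m m.+2 m.+3) (F (str t ++ s) b [::] [::]) (F s b [::] (rev (str t))) (5 * tsz t + 2).
Proof.
have := @swithin_scan t m m.+2 m.+3 (F (str t ++ s) b [::] [::]) s ne02 ne03 ne23.
by rewrite !frameE cats0; apply.
Qed.

Lemma swithin_pop_frame0 a b c d x : swithin (SPop m) (F (x :: a) b c d) (F a b c d) 1.
Proof. by have := swithin_pop m (F (x :: a) b c d); rewrite !frameE. Qed.
Lemma swithin_push_frame0 a b c d x : swithin (SPush m x) (F a b c d) (F (x :: a) b c d) 1.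
Proof. by have := swithin_push m x (F a b c d); rewrite !frameE. Qed.

End FrameMacros.

Lemma compile_correct p m B x :
  swithin (compile p m) (frame B m (str x) [::] [::] [::])
    (frame B m (str (feval p x)) [::] [::] [::]) (fcost p x).
Proof.
elim: p m B x => [||||f IHf g IHg|g IHg f IHf|c IHc f IHf g IHg|f IHf] m B x /=.
- exact: swithin_skip.
- apply: swithin_seq_le (swithin_clear_frame0 _ _ _ _ _ _) (swithin_le (swithin_push_frame0 _ _ _ _ _ _ _) _) _;
    by have := tsz_gt0 x; rewrite /tsz; lia.
- case: x => [|a b] /=.
    by apply: swithin_le (swithin_if _) _; [rewrite frame0; exact: swithin_skip|].
  have Ha := tsz_gt0 a; have Hb := tsz_gt0 b; rewrite tsz_node.
  apply: swithin_le (swithin_if _) _; rewrite ?frame0 /=.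
    apply: swithin_seq (swithin_pop_frame0 _ _ _ _ _ _ _) _.
    apply: swithin_seq (swithin_scan012 _ _ _ _ _) _.
    apply: swithin_seq (swithin_clear_frame0 _ _ _ _ _ _) _.
    by have := swithin_mv20 B m [::] (rev (str a)) [::]; rewrite revK; exact.
  by rewrite size_rev -!/(tsz _); lia.
- case: x => [|a b] /=.
    by apply: swithin_le (swithin_if _) _; [rewrite frame0; exact: swithin_skip|].
  have Ha := tsz_gt0 a; have Hb := tsz_gt0 b; rewrite tsz_node.
  apply: swithin_le (swithin_if _) _; rewrite ?frame0 /=.
    apply: swithin_seq (swithin_pop_frame0 _ _ _ _ _ _ _) _.
    apply: swithin_seq (swithin_scan012 _ _ _ _ _) _.
    exact: swithin_clear_frame2.
  by rewrite size_rev -!/(tsz _); lia.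
- have Hf := IHf m.+2 (frame B m (str x) [::] [::] [::]) x; rewrite -!frame_shift2 in Hf.
  set fx := feval f x in Hf *; set gx := feval g x.
  have Hg := IHg m.+2 (frame B m [::] (rev (str fx)) [::] [::]) x; rewrite -!frame_shift2 -/gx in Hg.
  have S1 := tsz_gt0 x; have S2 := tsz_gt0 fx; have S3 := tsz_gt0 gx.
  apply: swithin_seq_le (swithin_mv01 _ _ _ _ _) _ _; last by rewrite -/(tsz _); lia.
  have := swithin_mv2_102 B m (rev (str x)) [::]; rewrite revK => W.
  apply: swithin_seq_le W _ _; last by rewrite size_rev -/(tsz _); lia.
  apply: swithin_seq_le Hf _ _; last by rewrite size_rev -/(tsz _); lia.
  apply: swithin_seq_le (swithin_mv03 _ _ _ _ _) _ _; last by rewrite size_rev -/(tsz _); lia.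
  (* The value of [f] waits in reversed order on stack [m.+1], so that one final move puts it the
     right way round in front of the value of [g]. *)
  apply: swithin_seq_le (swithin_mv21 _ _ _ _ _) _ _; last by rewrite size_rev -!/(tsz _); lia.
  have := swithin_mv32 B m [::] (rev (str fx)) (rev (str x)); rewrite revK => {}W.
  apply: swithin_seq_le W _ _; last by rewrite !size_rev -!/(tsz _); lia.
  apply: swithin_seq_le Hg _ _; last by rewrite !size_rev -!/(tsz _); lia.
  apply: swithin_seq_le (swithin_mv23 _ _ _ _ _) _ _; last by rewrite !size_rev -!/(tsz _); lia.
  have := swithin_mv30 B m (rev (str fx)) [::] (rev (str gx)); rewrite revK => {}W.
  apply: swithin_seq_le W _ _; last by rewrite !size_rev -!/(tsz _); lia.
  have := swithin_mv10 B m (str gx) (rev (str fx)) [::] [::]; rewrite revK => {}W.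
  apply: swithin_seq_le W _ _; last by rewrite !size_rev -!/(tsz _); lia.
  by apply: swithin_le (swithin_push_frame0 _ _ _ _ _ _ _) _; rewrite !size_rev -!/(tsz _); lia.
- exact: swithin_seq (IHf _ _ _) (IHg _ _ _).
- set cx := feval c x; have S1 := tsz_gt0 x; have S2 := tsz_gt0 cx.
  have Hc := IHc m.+2 (frame B m (str x) [::] [::] [::]) x; rewrite -!frame_shift2 -/cx in Hc.
  apply: swithin_seq_le (swithin_mv01 _ _ _ _ _) _ _; last by rewrite -!/(tsz _); lia.
  have := swithin_mv2_102 B m (rev (str x)) [::]; rewrite revK => W.
  apply: swithin_seq_le W _ _; last by rewrite size_rev -!/(tsz _); lia.
  apply: swithin_seq_le Hc _ _; last by rewrite size_rev -!/(tsz _); lia.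
  set n' := if cx is Node _ _ then fcost f x else fcost g x.
  apply: swithin_le (swithin_if (n := 2 * tsz cx + 1 + n') _) _; rewrite ?frame2.
    have clr := swithin_clear_frame2 B m (str x) [::] (str cx) [::].
    case: (cx) @n' clr => [|u v] n' clr /=; first exact: swithin_seq clr (IHg _ _ _).
    exact: swithin_seq clr (IHf _ _ _).
  by rewrite size_rev -!/(tsz _); lia.
- case: x => [|c y] /=.
    by apply: swithin_le (swithin_if _) _; [rewrite frame0; exact: swithin_skip|].
  have Ha := tsz_gt0 c; have Hb := tsz_gt0 y; rewrite tsz_node.
  set z := titer _ c y; have Hz := tsz_gt0 z.
  (* A round pops one constructor of the spine, discards its label and applies [f] one stack higher;
     the closing [Leaf] stops the loop and leaves the symbol [false]. *)
  have loop : swithin (SWhile top_true m (SSeq (SPop m) (SSeq (scan m m.+2 m.+3) (SSeq (clear m.+3) (compile f m.+1)))))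
    (frame B m (str c) (str y) [::] [::]) (frame B m [:: false] (str z) [::] [::])
    (titer_cost (feval f) (fcost f) c y + 1 + 9 * tsz c).
    rewrite /z; elim: c y {Ha Hb z Hz} => [|a _ c IH] y /=.
      by apply: swithin_le (swithin_whileF _ _) _; rewrite ?frame0.
    have Hf := IHf m.+1 (frame B m (str c) [::] [::] [::]) y; rewrite -!frame_shift1 in Hf.
    have Ha := tsz_gt0 a; rewrite tsz_node.
    apply: swithin_le (swithin_whileT _ _ (IH _)) _; rewrite ?frame0 //.
      apply: swithin_seq (swithin_pop_frame0 _ _ _ _ _ _ _) _.
      apply: swithin_seq (swithin_scan023 _ _ _ _ _) _.
      exact: swithin_seq (swithin_clear_frame3 _ _ _ _ _ _) Hf.
    by rewrite size_rev -!/(tsz _); lia.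
  apply: swithin_le (swithin_if _) _; rewrite ?frame0 /=.
    apply: swithin_seq (swithin_pop_frame0 _ _ _ _ _ _ _) _.
    apply: swithin_seq (swithin_scan012 _ _ _ _ _) _.
    apply: swithin_seq (swithin_mv03 _ _ _ _ _) _.
    have := swithin_mv31 B m [::] (rev (str c)) (rev (str y)); rewrite revK => W.
    apply: swithin_seq W _.
    have := swithin_mv20 B m (str y) (rev (str c)) [::]; rewrite revK => {}W.
    apply: swithin_seq W _.
    apply: swithin_seq loop _.
    apply: swithin_seq (swithin_pop_frame0 _ _ _ _ _ _ _) _.
    apply: swithin_seq (swithin_mv12 _ _ _ _ _) _.
    by have := swithin_mv20 B m [::] (rev (str z)) [::]; rewrite revK; exact.
  by rewrite !size_rev -!/(tsz _); lia.
Qed.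

(** * Input words as trees, and the machine of a tree program *)

Definition enc_bool (b : bool) : tree := if b then Node Leaf Leaf else Leaf.

Definition enc_seq (A : Type) (e : A -> tree) (s : seq A) : tree :=
  foldr (fun a t => Node (e a) t) Leaf s.

(** With the last bit on top, the list of bits is built from its tail: each bit pushes the code of a
    new head, in reverse, onto stack 1. *)
Definition parse_input : scmd :=
  SSeq (SPush 1 false) (SSeq (SWhile isSome 0 (SIf top_true 0
    (SSeq (SPop 0) (SSeq (SPush 1 false) (SSeq (SPush 1 false) (SSeq (SPush 1 true) (SPush 1 true)))))
    (SSeq (SPop 0) (SSeq (SPush 1 false) (SPush 1 true)))))
  (SSeq (mv 1 2) (mv 2 0))).

Lemma tsz_enc_bits w : tsz (enc_seq enc_bool w) <= 4 * size w + 1.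
Proof. by elim: w => [|b w IH] //=; rewrite tsz_node; case: b; rewrite /= ?tsz_node /tsz /= in IH *; lia. Qed.

Lemma parse_input_correct w B : swithin parse_input (frame B 0 (rev w) [::] [::] [::])
  (frame B 0 (str (enc_seq enc_bool w)) [::] [::] [::]) (60 * size w + 20).
Proof.
have push i x S n : n = 1 -> swithin (SPush i x) S (upd S i (x :: S i)) n by move=> ->; exact: swithin_push.
pose loop := SWhile isSome 0 (SIf top_true 0
    (SSeq (SPop 0) (SSeq (SPush 1 false) (SSeq (SPush 1 false) (SSeq (SPush 1 true) (SPush 1 true)))))
    (SSeq (SPop 0) (SSeq (SPush 1 false) (SPush 1 true)))).
have H v u : swithin loop (frame B 0 (rev v) (str (enc_seq enc_bool u)) [::] [::])
    (frame B 0 [::] (str (enc_seq enc_bool (v ++ u))) [::] [::]) (7 * size v + 1).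
  elim/last_ind: v u => [|v b IH] u; first by apply: swithin_whileF; rewrite frame0.
  rewrite rev_rcons cat_rcons.
  apply: swithin_le (swithin_whileT (n1 := 6) _ _ (IH _)) _; rewrite ?frame0 //; last by rewrite size_rcons; lia.
  apply: swithin_if; rewrite frame0.
  case: b => /=; set s := str _.
    have := swithin_seq (swithin_pop_frame0 B 0 (rev v) s [::] [::] true) (swithin_seq (swithin_push 1 false _)
      (swithin_seq (swithin_push 1 false _) (swithin_seq (swithin_push 1 true _) (swithin_push 1 true _)))).
    by rewrite !(frame1 B 0, upd_frame1 B 0).
  have := swithin_seq (swithin_pop_frame0 B 0 (rev v) s [::] [::] false) (swithin_seq (swithin_push 1 false _)
      (swithin_push 1 true _)).
  by rewrite !(frame1 B 0, upd_frame1 B 0) => W; apply: swithin_le W _.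
have le := tsz_enc_bits w.
have start := swithin_push 1 false (frame B 0 (rev w) [::] [::] [::]).
rewrite (frame1 B 0) (upd_frame1 B 0) in start.
have := H w [::]; rewrite cats0 => W.
apply: swithin_seq_le start _ _; last lia.
apply: swithin_seq_le W _ _; last lia.
apply: swithin_seq_le (swithin_mv12 B 0 _ _ _) _ _; last by rewrite -!/(tsz _); lia.
have := swithin_mv20 B 0 [::] (rev (str (enc_seq enc_bool w))) [::]; rewrite revK => {}W.
by apply: swithin_le W _; rewrite !size_rev -!/(tsz _); lia.
Qed.

Definition machine (p : fn) : TM := stack_machine (SSeq parse_input (compile p 0)).

(** The square comes from the trips along the tracks, each linear in the input length plus the
    number of stack steps. A code starts with [true] exactly when its tree is a [Node], whence the
    form of acceptance. *)
Lemma machine_correct p w T : (200 * ((size w).+1 + fcost p (enc_seq enc_bool w))) ^ 2 <= T ->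
  let cf := tm_run (machine p) T w in
  tm_halted cf /\ (cst cf = tm_accept (machine p) <-> feval p (enc_seq enc_bool w) <> Leaf).
Proof.
move=> leT; set t := enc_seq enc_bool w in leT *.
have [n len X] := swithin_seq (parse_input_correct w (fun=> [::])) (compile_correct p 0 (fun=> [::]) t).
have E : input_store w = frame (fun=> [::]) 0 (rev w) [::] [::] [::].
  by apply: functional_extensionality => -[|[|[|[|[|j]]]]].
rewrite -E in X.
have [|h1 h2] := stack_machine_correct (T := T) X.
  apply: leq_trans leT; set s := _ + fcost p t.
  have ns : n <= 60 * s by rewrite /s -/t in len *; lia.
  have ws : (size w).+1 <= s by rewrite /s; lia.
  apply: (@leq_trans (60 * s * (6 * (61 * s) + 20) + 3 * (61 * s) + 11)).
    by rewrite leq_add2r; apply: leq_add; [apply: leq_mul|]; lia.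
  by nia.
split=> //; apply: (iff_trans h2); rewrite frame0; case: (feval p t) => [|a b] //=; split=> //.
Qed.

(** * Polynomial time *)

(* [meas] may exceed the size of the code: a fixed-parameter bound is a polynomial bound
   in a measure that also counts a function of the parameter. *)
Structure code := Code {
  carrier :> Type;
  enc : carrier -> tree;
  meas : carrier -> nat;
  tsz_lt_meas : forall a, tsz (enc a) < meas a }.

Lemma meas_ge2 (A : code) (a : A) : 1 < meas a.
Proof. by apply: leq_ltn_trans (tsz_gt0 (enc a)) (tsz_lt_meas a). Qed.

(** A pure power is enough: [meas] is at least 2, so constants and sums are absorbed by the
    exponent. *)
Definition poly_bounded (X : code) (g : X -> nat) := exists c, forall x, g x <= meas x ^ c.

Section PolyBounded.
Context (X : code).
Implicit Types g h : X -> nat.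

Lemma poly_le g h : poly_bounded h -> (forall x, g x <= h x) -> poly_bounded g.
Proof. by case=> c H le; exists c => x; apply: leq_trans (le x) (H x). Qed.

Lemma meas_exp_le (x : X) c d : c <= d -> meas x ^ c <= meas x ^ d.
Proof. by move=> le; rewrite leq_exp2l // meas_ge2. Qed.

Lemma poly_meas : poly_bounded (@meas X).
Proof. by exists 1 => x; rewrite expn1. Qed.

Lemma poly_const n : poly_bounded (fun _ : X => n).
Proof.
exists n => x; apply: leq_trans (ltnW (ltn_expl n (leqnn 2))) _.
by case: n => // n; rewrite leq_exp2r // meas_ge2.
Qed.

Lemma poly_add g h : poly_bounded g -> poly_bounded h -> poly_bounded (fun x => g x + h x).
Proof.
case=> c Hc [d Hd]; exists (maxn c d).+1 => x.
have H1 := leq_trans (Hc x) (meas_exp_le x (leq_maxl c d)).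
have H2 := leq_trans (Hd x) (meas_exp_le x (leq_maxr c d)).
by rewrite expnS; apply: leq_trans (leq_add H1 H2) _; rewrite addnn -mul2n leq_mul2r meas_ge2 orbT.
Qed.

Lemma poly_mul g h : poly_bounded g -> poly_bounded h -> poly_bounded (fun x => g x * h x).
Proof. by case=> c Hc [d Hd]; exists (c + d) => x; rewrite expnD leq_mul. Qed.

Lemma poly_exp g n : poly_bounded g -> poly_bounded (fun x => g x ^ n).
Proof. by case=> c Hc; exists (c * n) => x; rewrite expnM; case: n => // n; rewrite leq_exp2r. Qed.

End PolyBounded.

Lemma poly_comp (X Y : code) (f : X -> Y) (g : Y -> nat) :
  poly_bounded (fun x => meas (f x)) -> poly_bounded g -> poly_bounded (fun x => g (f x)).
Proof. by move=> H [c Hg]; apply: poly_le (poly_exp c H) _ => x; exact: Hg. Qed.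

Ltac pbound := repeat (assumption || apply: poly_add || apply: poly_mul || apply: poly_const || apply: poly_meas).

Lemma enc_nat_lt n : tsz (iter n (Node Leaf) Leaf) < n.*2.+2.
Proof. by elim: n => [|n IH] //=; rewrite tsz_node doubleS. Qed.
Canonical code_nat : code := Code enc_nat_lt.

Lemma enc_bool_lt b : tsz (enc_bool b) < 4.
Proof. by case: b. Qed.
Canonical code_bool : code := Code enc_bool_lt.

Lemma enc_prod_lt (A B : code) (x : A * B) :
  tsz (Node (enc x.1) (enc x.2)) < meas x.1 + meas x.2.
Proof. by rewrite tsz_node; have := tsz_lt_meas (x.1); have := tsz_lt_meas (x.2); lia. Qed.
Canonical code_prod (A B : code) : code :=
  Code (@enc_prod_lt A B).

Lemma enc_seq_lt (A : code) (s : seq A) :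
  tsz (enc_seq (@enc A) s) < foldr (fun a n => meas a + n) 2 s.
Proof. by elim: s => [|a s IH] //=; rewrite tsz_node; have := tsz_lt_meas a; lia. Qed.
Canonical code_seq (A : code) : code := Code (@enc_seq_lt A).

(** The third bound is a demand of its own, since a measure is not controlled by the size of the
    code; it is what makes composition preserve the other two. *)
Definition PT (X A : code) (f : X -> A) := exists p : fn,
  [/\ forall x : X, feval p (enc x) = enc (f x), poly_bounded (fun x : X => fcost p (enc x)) &
      poly_bounded (fun x : X => meas (f x))].

Section PT.
Context (X : code).

Lemma pt_id : PT (fun x : X => x).
Proof. by exists Id; split=> //=; pbound. Qed.

Lemma pt_meas (A : code) (f : X -> A) : PT f -> poly_bounded (fun x => meas (f x)).
Proof. by case=> p []. Qed.

Lemma pt_comp (A B : code) (g : A -> B) (f : X -> A) :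
  PT g -> PT f -> PT (fun x => g (f x)).
Proof.
case=> p [p1 p2 p3] [q [q1 q2 q3]]; exists (Comp p q); split=> [x||]; first by rewrite /= q1 p1.
  apply: (poly_le (poly_add q2 (poly_comp q3 p2))) => x; by rewrite /= q1.
exact: poly_comp q3 p3.
Qed.

Lemma poly_tsz (A : code) (f : X -> A) :
  poly_bounded (fun x => meas (f x)) -> poly_bounded (fun x => tsz (enc (f x))).
Proof. by move=> H; apply: poly_le H _ => x; apply: ltnW (tsz_lt_meas _). Qed.

Lemma pt_pair (A B : code) (f : X -> A) (g : X -> B) :
  PT f -> PT g -> PT (fun x => (f x, g x)).
Proof.
case=> p [p1 p2 p3] [q [q1 q2 q3]]; exists (Cons p q); split=> [x||]; first by rewrite /= p1 q1.
  pose h x := fcost p (enc x) + fcost q (enc x) + 30 * (meas x + tsz (enc (f x)) + tsz (enc (g x))).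
  apply: (@poly_le _ _ h); first by rewrite /h; pbound; exact: poly_tsz.
  by move=> x; rewrite /= p1 q1 /h; have := tsz_lt_meas x; lia.
by rewrite /=; pbound.
Qed.

Lemma pt_if (A : code) (b : X -> bool) (f g : X -> A) :
  PT b -> PT f -> PT g -> PT (fun x => if b x then f x else g x).
Proof.
case=> c [c1 c2 c3] [p [p1 p2 p3]] [q [q1 q2 q3]]; exists (Cond c p q); split=> [x||].
- by rewrite /= c1; case: (b x) => /=.
- pose h x := fcost c (enc x) + 20 * (meas x + tsz (enc (b x))) + (fcost p (enc x) + fcost q (enc x)).
  apply: (@poly_le _ _ h); first by rewrite /h; pbound; exact: poly_tsz.
  by move=> x; rewrite /= c1 /h; have := tsz_lt_meas x; case: (b x) => /=; lia.
by apply: (poly_le (poly_add p3 q3)) => x; case: ifP; lia.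
Qed.

Lemma pt_ext (A : code) (f g : X -> A) : f =1 g -> PT f -> PT g.
Proof.
move=> E [p [p1 p2 p3]]; exists p; split=> // [x|]; first by rewrite p1 E.
by apply: poly_le p3 _ => x; rewrite E.
Qed.

End PT.

Section Basic.
Context (A B : code).

Lemma pt_fst : PT (@fst A B).
Proof.
exists Car; split=> //=; first by apply: (poly_le (poly_mul (poly_const _ 20) (@poly_meas _))) => x; have := tsz_lt_meas x; rewrite /=; lia.
by apply: (poly_le (@poly_meas _)) => x /=; rewrite leq_addr.
Qed.

Lemma pt_snd : PT (@snd A B).
Proof.
exists Cdr; split=> //=; first by apply: (poly_le (poly_mul (poly_const _ 20) (@poly_meas _))) => x; have := tsz_lt_meas x; rewrite /=; lia.
by apply: (poly_le (@poly_meas _)) => x /=; rewrite leq_addl.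
Qed.

(** A nonempty list has the same code as the pair of its head and tail, so the program is the
    identity. *)
Lemma pt_cons : PT (fun x : A * seq A => x.1 :: x.2).
Proof.
by exists Id; split=> //=; [pbound | exact: (@poly_meas (code_prod A (code_seq A)))].
Qed.

Lemma pt_nil : PT (fun x : B => [::] : seq A).
Proof.
exists Nil; split=> //=; last by pbound.
by apply: (poly_le (poly_mul (poly_const _ 4) (@poly_meas _))) => x; have := tsz_lt_meas x; rewrite /=; lia.
Qed.

Lemma pt_behead : PT (@behead A).
Proof.
exists Cdr; split=> [[]//||].
  by apply: (poly_le (poly_mul (poly_const _ 20) (@poly_meas _))) => x; have := tsz_lt_meas x; rewrite /=; lia.
by apply: (poly_le (@poly_meas _)); case=> [|a s] //=; rewrite leq_addl.
Qed.

Lemma pt_seq_case (l : A -> seq B) (C : code) (f : A * (B * seq B) -> C) (g : A -> C) :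
  PT l -> PT f -> PT g -> PT (fun x => if l x is b :: s then f (x, (b, s)) else g x).
Proof.
case=> p [p1 p2 p3] [q [q1 [cq q2] [dq q3]]] [r [r1 r2 r3]].
have E x b s : l x = b :: s -> meas (x, (b, s)) = meas x + meas (l x) by move=> ->.
exists (Cond p (Comp q (Cons Id p)) r); split=> [x||].
- by rewrite /= p1; case: (l x) => [|b s] //=; rewrite -q1.
- pose h x := fcost p (enc x) + 20 * (meas x + tsz (enc (l x))) +
    (fcost p (enc x) + 1 + 30 * (meas x + meas x + tsz (enc (l x))) + (meas x + meas (l x)) ^ cq + fcost r (enc x)).
  apply: (@poly_le _ _ h).
    by rewrite /h; pbound; try exact: poly_tsz; apply: poly_exp; pbound.
  move=> x; rewrite /h /= p1; have := tsz_lt_meas x; case El: (l x) => [|b s]; first by rewrite /=; lia.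
  by have := q2 (x, (b, s)); rewrite (E _ _ _ El) El /=; set u := fcost q _; set v := _ ^ _; lia.
- apply: (@poly_le _ _ (fun x => (meas x + meas (l x)) ^ dq + meas (g x))).
    by pbound; apply: poly_exp; pbound.
  by move=> x; case El: (l x) => [|b s]; [lia | have := q3 (x, (b, s)); rewrite (E _ _ _ El) El; lia].
Qed.

End Basic.

Fixpoint spine t := if t is Node _ t' then (spine t').+1 else 0.

Lemma titerE F c y : titer F c y = iter (spine c) F y.
Proof. by elim: c y => [|a _ c IH] y //=; rewrite IH -iterSr. Qed.

Lemma spine_tsz c : spine c <= tsz c.
Proof. by elim: c => [|a _ c IH] //=; rewrite tsz_node; lia. Qed.

Lemma titer_cost_le F C c y K : (forall i, i < spine c -> C (iter i F y) <= K) ->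
  titer_cost F C c y <= spine c * K + 10 * tsz c.
Proof.
elim: c y => [|a _ c IH] y //= H.
have W : titer_cost F C c (F y) <= spine c * K + 10 * tsz c.
  by apply: IH => i le; rewrite -iterSr; exact: H.
by rewrite tsz_node; have := H 0 isT; rewrite mulSn /=; lia.
Qed.

Section Iteration.
Context (X Y : code).

(** Iterating a polynomial-time step can leave polynomial time only through the growth of the
    intermediate values; the bound [g] on all iterates excludes this and bounds the cost of every
    round. *)
Lemma pt_iter_spine (C : code) (c : X -> C) (F : Y -> Y) (y0 : X -> Y) g :
  PT c -> PT F -> PT y0 -> poly_bounded g ->
  (forall x i, i <= spine (enc (c x)) -> meas (iter i F (y0 x)) <= g x) ->
  PT (fun x => iter (spine (enc (c x))) F (y0 x)).
Proof.
case=> p [p1 p2 p3] [q [q1 [cq q2] _]] [r [r1 r2 r3]] Hg Hb.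
have it i x : iter i (feval q) (enc (y0 x)) = enc (iter i F (y0 x)).
  by elim: i => [|i IH] //=; rewrite IH q1.
exists (Comp (Iter q) (Cons p r)); split=> [x||].
- by rewrite /= p1 r1 titerE it.
- pose h x := fcost p (enc x) + fcost r (enc x) + 30 * (meas x + tsz (enc (c x)) + tsz (enc (y0 x))) +
    (30 * (1 + tsz (enc (c x)) + tsz (enc (y0 x))) + (tsz (enc (c x)) * (g x ^ cq) + 10 * tsz (enc (c x)) + 30 * g x)).
  apply: (@poly_le _ _ h).
    by rewrite /h; pbound; try exact: poly_tsz; apply: poly_exp.
  move=> x; rewrite /h /= p1 r1 tsz_node titerE it; have := tsz_lt_meas x.
  have := titer_cost_le (F := feval q) (C := fcost q) (c := enc (c x)) (y := enc (y0 x)) (K := g x ^ cq).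
  have H i : i < spine (enc (c x)) -> fcost q (iter i (feval q) (enc (y0 x))) <= g x ^ cq.
    move=> le; rewrite it; apply: leq_trans (q2 _) _.
    by case: (cq) => // n; rewrite leq_exp2r //; apply: Hb; apply: ltnW.
  move=> /(_ H); have := spine_tsz (enc (c x)) => s1.
  have := leq_mul s1 (leqnn (g x ^ cq)) => s2 s3.
  have := tsz_lt_meas (iter (spine (enc (c x))) F (y0 x)); have := Hb x _ (leqnn _) => s4 s5 s6.
  lia.
by apply: poly_le Hg _ => x; apply: Hb.
Qed.

End Iteration.

Lemma spine_nat (n : nat) : spine (enc n) = n.
Proof. by elim: n => [|n IH] //=; rewrite IH. Qed.

Lemma spine_seq (A : code) (s : seq A) : spine (enc s) = size s.
Proof. by elim: s => [|a s IH] //=; rewrite IH. Qed.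

Section Folds.
Context (X A B : code).

(** [Iter] applies a program without parameters, so [x] is carried along in the state. *)
Lemma pt_iter (n : X -> nat) (f : X * B -> B) (b : X -> B) g :
  PT n -> PT f -> PT b -> poly_bounded g ->
  (forall x i, i <= n x -> meas (iter i (fun a => f (x, a)) (b x)) <= g x) ->
  PT (fun x => iter (n x) (fun a => f (x, a)) (b x)).
Proof.
move=> Hn Hf Hb Hg H.
have it i x : iter i (fun y => (y.1, f y)) (x, b x) = (x, iter i (fun a => f (x, a)) (b x)).
  by elim: i => [|i IH] //=; rewrite IH.
have := @pt_iter_spine X (code_prod X B) code_nat n (fun y => (y.1, f y)) (fun x => (x, b x)) (fun x => meas x + g x).
move=> W; apply: pt_ext (pt_comp (@pt_snd X B) (W Hn _ _ _ _)).
- by move=> x; rewrite spine_nat it.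
- by apply: pt_pair => //; exact: pt_fst.
- by apply: pt_pair => //; exact: pt_id.
- by pbound.
- by move=> x i; rewrite spine_nat it /= => le; rewrite leq_add2l H.
Qed.

Lemma pt_foldl (l : X -> seq A) (f : X * (B * A) -> B) (b : X -> B) g :
  PT l -> PT f -> PT b -> poly_bounded g ->
  (forall x i, i <= size (l x) -> meas (foldl (fun b a => f (x, (b, a))) (b x) (take i (l x))) <= g x) ->
  PT (fun x => foldl (fun b a => f (x, (b, a))) (b x) (l x)).
Proof.
move=> Hl Hf Hb Hg H.
(* The state also holds the part of the list still unread, while the list itself serves as the
   counter of the loop. *)
pose F (y : X * (seq A * B)) := if y.2.1 is a :: s then (y.1, (s, f (y.1, (y.2.2, a)))) else y.
have it i x s b0 : i <= size s ->
    iter i F (x, (s, b0)) = (x, (drop i s, foldl (fun b a => f (x, (b, a))) b0 (take i s))).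
  elim: i => [|i IH] le; first by rewrite drop0 take0.
  rewrite /= IH ?(ltnW le) //; case: s le {IH} => // a s le.
  by rewrite /F [in LHS](drop_nth a le) (take_nth a le) -cats1 foldl_cat.
have meas_drop i (s : seq A) : meas (drop i s) <= meas s.
  by elim: s i => [|a s IH] [|i] //=; apply: leq_trans (IH i) (leq_addl _ _).
have PF : PT F.
  apply: (@pt_seq_case _ _ (fun y : X * (seq A * B) => y.2.1) _ (fun z : X * (seq A * B) * (A * seq A) =>
    (z.1.1, (z.2.2, f (z.1.1, (z.1.2.2, z.2.1)))))).
  - exact: pt_comp (@pt_fst _ _) (@pt_snd _ _).
  - have P11 : PT (fun z : X * (seq A * B) * (A * seq A) => z.1.1) := pt_comp (@pt_fst _ _) (@pt_fst _ _).
    apply: pt_pair => //; apply: pt_pair; first exact: pt_comp (@pt_snd _ _) (@pt_snd _ _).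
    apply: (pt_comp Hf); apply: pt_pair => //; apply: pt_pair; last exact: pt_comp (@pt_fst _ _) (@pt_snd _ _).
    by apply: pt_comp (@pt_snd _ _) (pt_comp (@pt_snd _ _) (@pt_fst _ _)).
  - exact: pt_id.
have := @pt_iter_spine X (code_prod X (code_prod (code_seq A) B)) (code_seq A) l F (fun x => (x, (l x, b x)))
  (fun x => meas x + (meas (l x) + g x)) Hl PF.
move=> W; apply: pt_ext (pt_comp (@pt_snd _ _) (pt_comp (@pt_snd _ _) (W _ _ _))).
- by move=> x; rewrite spine_seq it // take_size.
- by apply: pt_pair; [exact: pt_id | exact: pt_pair].
- by have Ml := pt_meas Hl; pbound.
- by move=> x i; rewrite spine_seq => le; rewrite it //= leq_add2l leq_add ?meas_drop ?H.
Qed.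

(** An increment that does not depend on the accumulator adds up to a polynomial over the whole
    list, whereas growth by a factor could be exponential. *)
Lemma pt_foldl_additive (l : X -> seq A) (f : X * (B * A) -> B) (b : X -> B) h :
  PT l -> PT f -> PT b -> poly_bounded h ->
  (forall x b a, meas a <= meas (l x) -> meas (f (x, (b, a))) <= meas b + h x) ->
  PT (fun x => foldl (fun b a => f (x, (b, a))) (b x) (l x)).
Proof.
move=> Hl Hf Hb Hh H.
apply: (@pt_foldl _ _ _ (fun x => meas (b x) + meas (l x) * h x)) => //.
  by have Ml := pt_meas Hl; have Mb := pt_meas Hb; pbound.
move=> x i le; have : forall s b0, meas s <= meas (l x) ->
    meas (foldl (fun b a => f (x, (b, a))) b0 s) <= meas b0 + size s * h x.
  elim=> [|a s IH] b0 /= Hs; first by rewrite addn0.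
  have /IH W : foldr (fun a n => meas a + n) 2 s <= meas (l x) by apply: leq_trans Hs; exact: leq_addl.
  apply: leq_trans (W _) _; rewrite mulSn addnA leq_add2r; apply: H.
  by apply: leq_trans Hs; exact: leq_addr.
have meas_take : meas (take i (l x)) <= meas (l x).
  elim: (l x) i {le} => [|a s IH] [|i] //=; last by rewrite leq_add2l; exact: IH.
  by apply: leq_trans (meas_ge2 a) (leq_addr _ _).
move=> /(_ (take i (l x)) (b x) meas_take) W; apply: leq_trans W _; rewrite leq_add2l leq_mul2r.
apply/orP; right; apply: leq_trans (_ : size (l x) <= _).
  by rewrite size_take; case: ltnP.
by elim: (l x) => [|a s IH] //=; exact: leq_add (ltnW (meas_ge2 a)) IH.
Qed.
End Folds.

(** * Lists, booleans and arithmetic in polynomial time *)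

Lemma tsz_leaf : tsz Leaf = 1.
Proof. by []. Qed.

Lemma pt_fst_of (X A B : code) (f : X -> A * B) : PT f -> PT (fun x => (f x).1).
Proof. exact: pt_comp (@pt_fst _ _). Qed.
Lemma pt_snd_of (X A B : code) (f : X -> A * B) : PT f -> PT (fun x => (f x).2).
Proof. exact: pt_comp (@pt_snd _ _). Qed.
Lemma pt_cons_of (X A : code) (f : X -> A) (g : X -> seq A) : PT f -> PT g -> PT (fun x => f x :: g x).
Proof. by move=> Hf Hg; exact: pt_comp (@pt_cons A) (pt_pair Hf Hg). Qed.

(** Supplies the uniform increment for additive folds whose step applies [f] to the elements of
    [l x]. *)
Lemma pt_elem (X A B : code) (l : X -> seq A) (f : X * A -> B) : PT l -> PT f ->
  exists2 h, poly_bounded h & forall x a, meas a <= meas (l x) -> meas (f (x, a)) <= h x.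
Proof.
move=> Hl [p [_ _ [c Hc]]]; exists (fun x => (meas x + meas (l x)) ^ c).
  by apply: poly_exp; have Ml := pt_meas Hl; pbound.
move=> x a le; apply: leq_trans (Hc _) _; case: (c) => // n.
by rewrite leq_exp2r // leq_add2l.
Qed.

Lemma pt_rev_append (X A : code) (l acc : X -> seq A) : PT l -> PT acc -> PT (fun x => catrev (l x) (acc x)).
Proof.
move=> Hl Ha; have := @pt_foldl_additive X A (code_seq A) l (fun z => z.2.2 :: z.2.1) acc (fun x => meas (l x)) Hl.
have P : PT (fun z : X * (seq A * A) => z.2.2 :: z.2.1).
  by apply: pt_cons_of; [exact: pt_comp (@pt_snd _ _) (@pt_snd _ _) | exact: pt_comp (@pt_fst _ _) (@pt_snd _ _)].
move=> /(_ P Ha (pt_meas Hl)) W; apply: pt_ext (W _).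
  by move=> x; elim: (l x) (acc x) => [|a s IH] b //=; rewrite -IH.
by move=> x b a le /=; rewrite addnC leq_add2l.
Qed.

Lemma pt_rev (X A : code) (l : X -> seq A) : PT l -> PT (fun x => rev (l x)).
Proof. by move=> Hl; apply: pt_rev_append => //; exact: pt_nil. Qed.

Lemma pt_cat (X A : code) (l r : X -> seq A) : PT l -> PT r -> PT (fun x => l x ++ r x).
Proof.
move=> Hl Hr; apply: pt_ext (pt_rev_append (pt_rev Hl) Hr) => x.
by rewrite catrevE revK.
Qed.

Lemma pt_map (X A B : code) (l : X -> seq A) (f : X * A -> B) :
  PT l -> PT f -> PT (fun x => map (fun a => f (x, a)) (l x)).
Proof.
move=> Hl Hf; have [h Hh le] := pt_elem Hl Hf.
have P : PT (fun z : X * (seq B * A) => f (z.1, z.2.2) :: z.2.1).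
  apply: pt_cons_of; last by apply: pt_fst_of; exact: pt_snd.
  by apply: (pt_comp Hf); apply: pt_pair; [exact: pt_fst | apply: pt_snd_of; exact: pt_snd].
have := @pt_foldl_additive X A (code_seq B) l (fun z => f (z.1, z.2.2) :: z.2.1) (fun=> [::]) h Hl P (pt_nil _ _) Hh.
move=> W; apply: pt_ext (pt_rev (W _)).
  move=> x /=; rewrite -[RHS]revK; congr rev; rewrite -[RHS]cats0; move: [::].
  by elim: (l x) => [|a s IH] b //=; rewrite IH rev_cons cat_rcons.
by move=> x b a Hle /=; rewrite addnC leq_add2l; exact: le.
Qed.

Lemma pt_flatten (X A : code) (l : X -> seq (seq A)) : PT l -> PT (fun x => flatten (l x)).
Proof.
move=> Hl.
have P : PT (fun z : X * (seq A * seq A) => z.2.1 ++ z.2.2).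
  by apply: pt_cat; [apply: pt_fst_of | apply: pt_snd_of]; exact: pt_snd.
have := @pt_foldl_additive X (code_seq A) (code_seq A) l (fun z => z.2.1 ++ z.2.2) (fun=> [::]) _ Hl P (pt_nil _ _) (pt_meas Hl).
move=> W; apply: pt_ext (W _).
  move=> x /=; rewrite -[RHS]cat0s; move: [::].
  by elim: (l x) => [|a s IH] b //=; rewrite ?cats0 // IH catA.
move=> x b a le; apply: (@leq_trans (meas b + meas a)); last by rewrite leq_add2l.
by elim: (b : seq A) => [|c s IH] /=; [exact: leq_addl | rewrite -addnA leq_add2l].
Qed.

Lemma pt_true (X : code) : PT (fun x : X => true).
Proof.
exists (Cons Nil Nil); split=> //=; last by pbound.
apply: (poly_le (poly_mul (poly_const _ 100) (@poly_meas X))) => x.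
by have := tsz_lt_meas x; have := tsz_gt0 (enc x); rewrite /= !tsz_leaf; lia.
Qed.

Lemma pt_false (X : code) : PT (fun x : X => false).
Proof.
exists Nil; split=> //=; last by pbound.
apply: (poly_le (poly_mul (poly_const _ 100) (@poly_meas X))) => x.
by have := tsz_lt_meas x; lia.
Qed.

Lemma pt_neg (X : code) (b : X -> bool) : PT b -> PT (fun x => ~~ b x).
Proof. by move=> Hb; exact: pt_if Hb (pt_false _) (pt_true _). Qed.
Lemma pt_and (X : code) (b c : X -> bool) : PT b -> PT c -> PT (fun x => b x && c x).
Proof. by move=> Hb Hc; exact: pt_if Hb Hc (pt_false _). Qed.
Lemma pt_or (X : code) (b c : X -> bool) : PT b -> PT c -> PT (fun x => b x || c x).
Proof. by move=> Hb Hc; exact: pt_if Hb (pt_true _) Hc. Qed.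

Lemma pt_has (X A : code) (l : X -> seq A) (p : X * A -> bool) : PT l -> PT p -> PT (fun x => has (fun a => p (x, a)) (l x)).
Proof.
move=> Hl Hp.
have P : PT (fun z : X * (bool * A) => z.2.1 || p (z.1, z.2.2)).
  apply: pt_or; first by apply: pt_fst_of; exact: pt_snd.
  by apply: (pt_comp Hp); apply: pt_pair; [exact: pt_fst | apply: pt_snd_of; exact: pt_snd].
have := @pt_foldl_additive X A code_bool l (fun z => z.2.1 || p (z.1, z.2.2)) (fun=> false) _ Hl P (pt_false _) (poly_const _ 4).
move=> W; apply: pt_ext (W _) => //.
move=> x /=; rewrite -[RHS]orFb; move: false.
by elim: (l x) => [|a s IH] b /=; rewrite ?orbF // IH orbA.
Qed.

Lemma pt_filter (X A : code) (l : X -> seq A) (p : X * A -> bool) : PT l -> PT p -> PT (fun x => filter (fun a => p (x, a)) (l x)).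
Proof.
move=> Hl Hp.
have P : PT (fun z : X * A => if p z then [:: z.2] else [::]).
  by apply: pt_if => //; [apply: pt_cons_of; [exact: pt_snd | exact: pt_nil] | exact: pt_nil].
apply: pt_ext (pt_flatten (pt_map Hl P)) => x.
by elim: (l x) => [|a s IH] //=; rewrite IH; case: (p _).
Qed.

Lemma pt_head (X A : code) (d : X -> A) (l : X -> seq A) : PT d -> PT l -> PT (fun x => head (d x) (l x)).
Proof.
move=> Hd Hl; apply: (@pt_ext X A (fun x => if l x is a :: s then (x, (a, s)).2.1 else d x)).
  by move=> x; case: (l x).
by apply: (@pt_seq_case X A l A (fun z => z.2.1) d) => //; apply: pt_fst_of; exact: pt_snd.
Qed.

Lemma pt_0 (X : code) : PT (fun x : X => 0).
Proof.
exists Nil; split=> //=; last by pbound.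
apply: (poly_le (poly_mul (poly_const _ 100) (@poly_meas X))) => x.
by have := tsz_lt_meas x; lia.
Qed.

Lemma pt_succ (X : code) (n : X -> nat) : PT n -> PT (fun x => (n x).+1).
Proof.
case=> p [p1 p2 p3]; exists (Cons Nil p); split=> [x||]; first by rewrite /= p1.
  apply: (@poly_le _ _ (fun x => 4 * meas x + fcost p (enc x) + 30 * (1 + meas x + tsz (enc (n x))))).
    by pbound; exact: poly_tsz.
  by move=> x; have := tsz_lt_meas x; rewrite /= p1 /= tsz_leaf; lia.
apply: (poly_le (poly_add (poly_const _ 2) p3)) => x.
by rewrite /= doubleS.
Qed.

Lemma pt_pred (X : code) (n : X -> nat) : PT n -> PT (fun x => (n x).-1).
Proof.
apply: (@pt_comp _ code_nat code_nat predn); exists Cdr; split=> [[]//||].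
  by apply: (poly_le (poly_mul (poly_const _ 20) (@poly_meas _))) => x; have := tsz_lt_meas x; rewrite /=; lia.
by apply: (poly_le (@poly_meas _)) => x /=; lia.
Qed.

Lemma pt_eq0 (X : code) (n : X -> nat) : PT n -> PT (fun x => n x == 0).
Proof.
apply: (@pt_comp _ code_nat code_bool (fun n => n == 0)); exists (Cond Id Nil (Cons Nil Nil)); split=> [[]//||].
  apply: (poly_le (poly_mul (poly_const _ 200) (@poly_meas _))) => x; have := tsz_lt_meas x.
  by have := tsz_gt0 (enc x); case: x => [|k]; rewrite /= ?tsz_node !tsz_leaf; lia.
by rewrite /=; pbound.
Qed.

Lemma poly_nat (X : code) (n : X -> nat) : PT n -> poly_bounded n.
Proof. by move=> /pt_meas H; apply: poly_le H _ => x /=; lia. Qed.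

Lemma pt_addn (X : code) (m n : X -> nat) : PT m -> PT n -> PT (fun x => m x + n x).
Proof.
move=> Hm Hn; apply: (@pt_ext X code_nat (fun x => iter (m x) (fun a => (x, a).2.+1) (n x))).
  by move=> x; elim: (m x) => [|k IH] //=; rewrite IH.
apply: (@pt_iter X code_nat m (fun z => z.2.+1) n (fun x => meas (m x) + meas (n x))) => //.
- by apply: pt_succ; exact: pt_snd.
- by have Mm := pt_meas Hm; have Mn := pt_meas Hn; pbound.
move=> x i le; have -> : iter i (fun a => (x, a).2.+1) (n x) = i + n x.
  by elim: i {le} => [|i IH] //=; rewrite IH.
by rewrite /=; lia.
Qed.

Lemma pt_subn (X : code) (m n : X -> nat) : PT m -> PT n -> PT (fun x => m x - n x).
Proof.
move=> Hm Hn; apply: (@pt_ext X code_nat (fun x => iter (n x) (fun a => (x, a).2.-1) (m x))).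
  by move=> x; elim: (n x) => [|k IH] //=; rewrite ?subn0 // IH subnS.
apply: (@pt_iter X code_nat n (fun z => z.2.-1) m (fun x => meas (m x))) => //.
- by apply: pt_pred; exact: pt_snd.
- exact: pt_meas.
move=> x i _; have : iter i (fun a => (x, a).2.-1) (m x) <= m x.
  by elim: i => [|i IH] //; apply: leq_trans IH; rewrite iterS leq_pred.
by rewrite /= !ltnS leq_double.
Qed.

Lemma pt_leq (X : code) (m n : X -> nat) : PT m -> PT n -> PT (fun x => m x <= n x).
Proof. by move=> Hm Hn; apply: pt_eq0; exact: pt_subn. Qed.

Lemma pt_eqn (X : code) (m n : X -> nat) : PT m -> PT n -> PT (fun x => m x == n x).
Proof.
move=> Hm Hn; apply: (pt_ext (f := fun x => (m x <= n x) && (n x <= m x))); last by apply: pt_and; exact: pt_leq.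
by move=> x; rewrite eqn_leq.
Qed.

Lemma pt_size (X : code) (A : code) (l : X -> seq A) : PT l -> PT (fun x => size (l x)).
Proof.
move=> Hl; have := @pt_foldl_additive X A code_nat l (fun z => z.2.1.+1) (fun=> 0) _ Hl _ (pt_0 _) (poly_const _ 2).
move=> W; apply: pt_ext (W _ _).
- move=> x /=; rewrite -[RHS]addn0; move: 0; elim: (l x) => [|a s IH] k //=.
  by rewrite IH; lia.
- by apply: pt_succ; apply: pt_fst_of; exact: pt_snd.
- by move=> x b a _ /=; lia.
Qed.

Lemma pt_drop (X : code) (A : code) (n : X -> nat) (l : X -> seq A) : PT n -> PT l -> PT (fun x => drop (n x) (l x)).
Proof.
move=> Hn Hl; have it i x : iter i (fun a => behead (x, a).2) (l x) = drop i (l x).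
  by elim: i => [|i IH] /=; rewrite ?drop0 // IH -drop1 drop_drop.
apply: (pt_ext (f := fun x => iter (n x) (fun a => behead (x, a).2) (l x))); first by move=> x; exact: it.
apply: (@pt_iter X (code_seq A) n (fun z => behead z.2) l (fun x => meas (l x))) => //.
- exact: pt_comp (@pt_behead _) (@pt_snd _ _).
- exact: pt_meas.
move=> x i _; rewrite it; elim: (l x) i => [|a s IH] [|i] //=.
by apply: leq_trans (IH i) (leq_addl _ _).
Qed.

Lemma pt_nth (X : code) (A : code) (d : X -> A) (l : X -> seq A) (n : X -> nat) : PT d -> PT l -> PT n -> PT (fun x => nth (d x) (l x) (n x)).
Proof.
move=> Hd Hl Hn; apply: pt_ext (pt_head Hd (pt_drop Hn Hl)) => x.
by elim: (l x) (n x) => [|a s IH] [|i] //=; rewrite -IH.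
Qed.

Lemma pt_iota0 (X : code) (n : X -> nat) : PT n -> PT (fun x => iota 0 (n x)).
Proof.
move=> Hn; have it i x : iter i (fun a => size (x, a).2 :: (x, a).2) [::] = rev (iota 0 i).
  by elim: i => [|i IH] //; rewrite iterS IH -addn1 iotaD rev_cat /= size_rev size_iota.
apply: (pt_ext (f := fun x => rev (iter (n x) (fun a => size (x, a).2 :: (x, a).2) [::]))).
  by move=> x; rewrite it revK.
apply: pt_rev; apply: (@pt_iter X (code_seq code_nat) n (fun z => size z.2 :: z.2) (fun=> [::])
  (fun x => meas (n x) * meas (n x) + 2)) => //.
- by apply: pt_cons_of; [apply: pt_size |]; exact: pt_snd.
- exact: pt_nil.
- by have Mn := pt_meas Hn; pbound.
move=> x i le; have H j : j <= n x -> meas (iter j (fun a => size (x, a).2 :: (x, a).2) [::]) <= j * meas (n x) + 2.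
  elim: j => [|j IH] lej //; rewrite iterS it /= size_rev size_iota mulSn.
  have := IH (ltnW lej); rewrite it /= => {}IH.
  by rewrite -addnA leq_add // !ltnS leq_double ltnW.
apply: leq_trans (H i le) _; rewrite leq_add2r leq_mul2r; apply/orP; right.
by rewrite /=; lia.
Qed.

(** * Representative trails *)

Definition edge := (nat * nat)%type.

Fixpoint edges (s : nat) (p : seq nat) : seq edge :=
  if p is v :: p' then (s, v) :: edges v p' else [::].

Definition mem_edge (e : edge) (F : seq edge) := has (fun a => (e.1 == a.1) && (e.2 == a.2)) F.

Definition avoids (F T : seq edge) := ~~ has (fun e => mem_edge e F) T.

(** A list of length at most 1 in the role of an option, so that [flatten] drops the guesses that no
    member of [C] avoids. *)
Definition first_avoiding (C : seq (seq edge)) F := take 1 (filter (avoids F) C).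

(** The first component holds the current guesses, the second the members selected so far. [take k]
    bounds the branching whatever the length of [T]. *)
Definition branch k C (st : seq (seq edge) * seq (seq edge)) : seq (seq edge) * seq (seq edge) :=
  (flatten (map (fun F => flatten (map (fun T => map (fun e => e :: F) (take k T)) (first_avoiding C F))) st.1),
   flatten (map (first_avoiding C) st.1) ++ st.2).

(* A representative family: whenever some [T] in [C] (of length at most [k]) avoids a set [X]
   of at most [q] edges, so does some member of [reduce k q C]. A branch is a set [F] of edges
   guessed to lie in [X]. *)
Definition reduce k q C := (iter q.+1 (branch k C) ([:: [::]], [::])).2.

(** A family member is stored as its end vertex and its edges in reverse order, so that appending an
    edge is a cons. *)
Definition candidates (e : rel nat) (R : seq (nat * seq edge)) v :=
  map (fun r => (r.1, v) :: r.2) (filter (fun r => e r.1 v && ~~ mem_edge (r.1, v) r.2) R).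

Definition extend n e k q R : seq (nat * seq edge) :=
  flatten (map (fun v => map (fun T => (v, T)) (reduce k q (candidates e R v))) (iota 0 n)).

Definition representatives n e k q s i := iter i (extend n e k q) [:: (s, [::])].

Definition spread n (e : rel nat) F S :=
  filter (fun v => has (fun u => (u == v) || (e u v && ~~ mem_edge (u, v) F)) S) (iota 0 n).

Definition reach n e F m s := iter m (spread n e F) [:: s].

Lemma mem_edgeE e F : mem_edge e F = (e \in F).
Proof. by case: e => u v; elim: F => [|[a b] F IH] //=; rewrite inE IH xpair_eqE. Qed.

Lemma avoidsP F T : reflect (forall e, e \in T -> e \notin F) (avoids F T).
Proof.
rewrite /avoids -all_predC; apply: (iffP allP) => H e /H /=; by rewrite mem_edgeE.
Qed.

Lemma edges_cat s p q : edges s (p ++ q) = edges s p ++ edges (last s p) q.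
Proof. by elim: p s => [|v p IH] s //=; rewrite IH. Qed.

Lemma size_edges s p : size (edges s p) = size p.
Proof. by elim: p s => [|v p IH] s //=; rewrite IH. Qed.

Lemma mem_edges s p u v : (u, v) \in edges s p -> exists c d, p = c ++ v :: d /\ last s c = u.
Proof.
elim: p s => [|w p IH] s //=; rewrite inE xpair_eqE => /orP [/andP [/eqP -> /eqP ->]|/IH [c [d [-> <-]]]].
  by exists [::], p.
by exists (w :: c), d.
Qed.

Lemma first_avoidingP C F T : T \in C -> avoids F T ->
  exists2 T', first_avoiding C F = [:: T'] & (T' \in C) && avoids F T'.
Proof.
move=> TC TF; rewrite /first_avoiding; have : T \in filter (avoids F) C by rewrite mem_filter TF.
case E: (filter _ C) => [|T' C'] // _; exists T'; first by rewrite /= take0.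
by have : T' \in filter (avoids F) C by [rewrite E mem_head]; rewrite mem_filter andbC.
Qed.

Lemma first_avoiding_sub C F T : T \in first_avoiding C F -> T \in C.
Proof. by move/mem_take; rewrite mem_filter => /andP []. Qed.

Lemma reduce_sub k q C T : T \in reduce k q C -> T \in C.
Proof.
rewrite /reduce; elim: q.+1 => [|j IH] //; rewrite iterS /= mem_cat => /orP [|/IH //].
by move/flatten_mapP => [F _ /first_avoiding_sub].
Qed.

(** If the member selected for a guess [F] inside [X] meets [X], the edge where it does so extends
    [F] inside [X], and is new because the member avoids [F]. Failure in all [q.+1] rounds would
    thus give [q.+1] distinct edges in [X]. *)
Lemma reduce_represents k q C T X : (forall T, T \in C -> size T <= k) -> T \in C -> size X <= q ->
  avoids X T -> exists2 T', T' \in reduce k q C & avoids X T'.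
Proof.
move=> Ck TC Xq TX.
pose out (st : seq (seq edge) * seq (seq edge)) := exists2 T', T' \in st.2 & avoids X T'.
have H j : let st := iter j (branch k C) ([:: [::]], [::]) in
    out st \/ exists2 F, F \in st.1 & [/\ uniq F, {subset F <= X} & size F = j].
  elim: j => [|j IH]; first by right; exists [::].
  rewrite iterS; set st := iter j _ _ in IH *; move: IH => /= [[T' T'st T'X]|[F Fst [uF FX sF]]].
    by left; exists T' => //=; rewrite mem_cat T'st orbT.
  have TF : avoids F T by apply/avoidsP => e /(avoidsP _ _ TX); apply: contra; exact: FX.
  have [T' E /andP [T'C T'F]] := first_avoidingP TC TF.
  have [T'X|/negbNE /hasP [e eT']] := boolP (avoids X T').
    by left; exists T' => //=; rewrite mem_cat; apply/orP; left; apply/flatten_mapP; exists F => //; rewrite E mem_head.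
  rewrite mem_edgeE => eX; right; exists (e :: F) => /=.
    apply/flatten_mapP; exists F => //; rewrite E /= cats0; apply/mapP; exists e => //.
    by rewrite take_oversize // Ck.
  split=> /=; [|by move=> a; rewrite inE => /orP [/eqP ->|/FX]|by rewrite sF].
  by rewrite uF andbT; exact: (avoidsP _ _ T'F).
case: (H q.+1) => // -[F _ [uF FX sF]].
by have := uniq_leq_size uF FX; rewrite sF ltnNge Xq.
Qed.

Section Trails.
Variables (n : nat) (e : rel nat).
Hypothesis e_lt : forall u v, e u v -> (u < n) && (v < n).

Definition trail s p := path e s p && uniq (edges s p).

Lemma trail_cat s p q : trail s (p ++ q) =
  [&& trail s p, trail (last s p) q & ~~ has (mem (edges s p)) (edges (last s p) q)].
Proof.
rewrite /trail cat_path edges_cat cat_uniq.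
by do ![case: (path _ _ _) => //=]; do ![case: (uniq _) => //=]; rewrite ?andbF ?andbT.
Qed.

Section Representatives.
Variables (k q s : nat).
Hypothesis kq : k <= q.
Notation R := (representatives n e k q s).

Lemma representatives_sound i r : r \in R i ->
  exists p, [/\ trail s p, last s p = r.1, r.2 = rev (edges s p) & size p = i].
Proof.
elim: i r => [|i IH] r; first by rewrite inE => /eqP ->; exists [::].
rewrite /representatives iterS -/(R i) => /flatten_mapP [v _ /mapP [T /reduce_sub TC ->]].
case/mapP: TC => -[u T']; rewrite mem_filter => /andP [/= /andP [euv nin] /IH [p [tp lp Tp sp]]] ->.
rewrite /= in lp Tp; exists (rcons p v); rewrite last_rcons size_rcons sp /= -cats1; split=> //; last first.
  by rewrite edges_cat rev_cat /= lp Tp.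
move: tp nin; rewrite trail_cat /= lp => ->; rewrite mem_edgeE Tp mem_rev => /negbTE nin.
by rewrite /trail /= euv nin.
Qed.

(** The last edge [(u, v)] is added to [X] before the induction hypothesis is used, so the
    representative of the shorter trail does not contain it and can be extended by it. This spends
    one unit of [q] per edge. *)
Lemma representatives_complete i p X : i <= k -> trail s p -> size p = i -> size X + i <= q ->
  avoids X (edges s p) -> exists r, [/\ r \in R i, r.1 = last s p & avoids X r.2].
Proof.
elim: i p X => [|i IH] p X ik tp sp Xq pX.
  by case: p sp {tp pX} => // _; exists (s, [::]); split; rewrite ?inE.
case/lastP: p sp tp pX => [//|p v]; rewrite size_rcons => -[sp]; rewrite -cats1 trail_cat last_cat => /and3P [tp].
rewrite edges_cat /trail /= !andbT orbF => euv nin pX; set u := last s p in euv nin pX *.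
have [||r [rR ru rX]] := IH p ((u, v) :: X) (ltnW ik) tp sp.
- by move: Xq; rewrite /=; lia.
- apply/avoidsP => a ap; rewrite inE negb_or (avoidsP _ _ pX) ?mem_cat ?ap // andbT.
  by apply: contra nin => /eqP <-.
have nir : (u, v) \notin r.2.
  by apply/negP => /(avoidsP _ _ rX); rewrite mem_head.
have cand : (u, v) :: r.2 \in candidates e (R i) v.
  apply/mapP; exists r; rewrite ?ru // mem_filter rR ru euv mem_edgeE nir //.
have csz T : T \in candidates e (R i) v -> size T <= k.
  case/mapP => r'; rewrite mem_filter => /andP [_ /representatives_sound [p' [_ _ E sp']]] ->.
  by rewrite /= E size_rev size_edges sp'.
have uvX : avoids X ((u, v) :: r.2).
  apply/avoidsP => a; rewrite inE => /orP [/eqP ->|ar].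
    by apply: (avoidsP _ _ pX); rewrite mem_cat inE eqxx orbT.
  by have := avoidsP _ _ rX a ar; rewrite inE negb_or => /andP [].
have Xq' : size X <= q by apply: leq_trans Xq; exact: leq_addr.
have [T' T'r T'X] := reduce_represents csz cand Xq' uvX.
exists (v, T'); split=> //.
apply/flatten_mapP; exists v; first by rewrite mem_iota /=; have /andP [] := e_lt euv.
exact: map_f.
Qed.

End Representatives.

Lemma reachP F m s t : s < n ->
  reflect (exists p, [/\ path (fun u v => e u v && ((u, v) \notin F)) s p, last s p = t & size p <= m])
    (t \in reach n e F m s).
Proof.
move=> sn; elim: m t => [|m IH] t.
  rewrite inE; apply: (iffP eqP) => [->|[p []]]; first by exists [::].
  by case: p => //= _ ->.
rewrite /reach iterS -/(reach n e F m s) mem_filter.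
apply: (iffP andP) => [[/hasP [u ur /orP [/eqP <-|/andP [eut nin]]] _]|[p [pp lp sp]]].
- by have /IH [p [pp lp sp]] := ur; exists p; split=> //; exact: leqW.
- have /IH [p [pp lp sp]] := ur; exists (rcons p t); rewrite rcons_path last_rcons size_rcons lp pp eut /=.
  by rewrite -mem_edgeE.
case/lastP: p pp lp sp => [_ /= <- _|p v].
  split; last by rewrite mem_iota.
  by apply/hasP; exists s; [apply/IH; exists [::] | rewrite eqxx].
rewrite rcons_path last_rcons size_rcons => /andP [pp /andP [ev nin]] <- sp.
split; last by rewrite mem_iota /=; have /andP [] := e_lt ev.
apply/hasP; exists (last s p); first by apply/IH; exists p.
by rewrite ev mem_edgeE nin orbT.
Qed.

(** Once the vertices are made distinct so are the edges, since no two edges of such a path leave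
    the same vertex. Keeping [e'] preserves the avoidance of used edges. *)
Lemma trail_path s p (e' : rel nat) : path e' s p -> subrel e' e -> exists p',
  [/\ trail s p', path e' s p', last s p' = last s p, uniq (s :: p') & size p' <= size p].
Proof.
move=> pp sub; case/shortenP: pp => p' pp' up' subp.
exists p'; split=> //; last by apply: uniq_leq_size => //; case/andP: up'.
rewrite /trail (sub_path sub) //=; elim: p' s up' {pp' subp} => [|v p' IH] s //= /and3P [sn vn up'].
rewrite IH /= ?vn // andbT; apply: contra sn => /mem_edges [c [d [-> <-]]].
rewrite -cat_cons mem_cat; apply/orP; left; exact: mem_last.
Qed.

Lemma disjoint_edges_split s p (E : seq edge) : has (mem E) (edges s p) -> exists a w b,
  [/\ p = a ++ w :: b, (last s a, w) \in E & ~~ has (mem E) (edges s a)].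
Proof.
elim: p s => [|v p IH] s //=; case: (boolP ((s, v) \in E)) => [svE _|svE /= /IH [a [w [b [-> H1 H2]]]]].
  by exists [::], v, p.
by exists (v :: a), w, b; rewrite /= negb_or svE.
Qed.

(* Replacing the first [k] edges of a trail by a representative that avoids its last [k] edges
   either keeps it a trail or yields a shorter trail that still has at least [k] edges. *)
Lemma representatives_atleast k q s p : k + k <= q -> trail s p -> k <= size p ->
  exists r p', [/\ r \in representatives n e k q s k,
    path (fun u v => e u v && ((u, v) \notin r.2)) r.1 p' & last r.1 p' = last s p].
Proof.
move=> kq; have [m] := ubnP (size p); elim: m p => // m IHm p pm tp kp.
set p1 := take k p; pose p2 := drop k p; have Ep : p = p1 ++ p2 by rewrite cat_take_drop.
have sp1 : size p1 = k by rewrite size_takel.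
move: tp; rewrite {1}Ep trail_cat => /and3P [tp1 tp2 d12]; set v := last s p1 in tp2 d12.
(* By truncated subtraction [q2] is all of [p2] when fewer than [k] edges remain. *)
pose q1 := take (size p2 - k) p2; pose q2 := drop (size p2 - k) p2.
have Ep2 : p2 = q1 ++ q2 by rewrite cat_take_drop.
pose X := edges (last v q1) q2.
have Xk : size X <= k by rewrite size_edges size_drop; lia.
have p1X : avoids X (edges s p1).
  apply/avoidsP => a ap; apply: contra d12 => aX; apply/hasP; exists a => //.
  by rewrite Ep2 edges_cat mem_cat aX orbT.
have [|r [rR rv rX]] := representatives_complete (leq_trans (leq_addr k k) kq) (leqnn k) tp1 sp1 _ p1X.
  by apply: leq_trans kq; rewrite leq_add2r.
have [hit|nohit] := boolP (has (mem r.2) (edges v p2)); last first.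
  exists r, p2; rewrite rv -/v; split=> //; last by rewrite Ep last_cat.
  move: tp2 => /andP [pp2 _]; elim: p2 (v) pp2 nohit {Ep q1 q2 Ep2 X Xk p1X rX d12} => [|w p3 IH] u //=.
  by move=> /andP [-> /IH {}IH]; rewrite negb_or => /andP [-> /IH].
have [p1' [tp1' lp1' Er sp1']] := representatives_sound rR.
have hit' : has (mem (edges v p2)) (edges s p1').
  by case/hasP: hit => f f2; rewrite /= Er mem_rev => f1; apply/hasP; exists f.
have [a [w [b [Ep1' aE ndis]]]] := disjoint_edges_split hit'.
have [c [d [Ecd lc]]] := mem_edges aE.
have eaw : (last s a, w) \in r.2.
  by rewrite Er mem_rev Ep1' edges_cat /= mem_cat inE eqxx orbT.
have Ecde : edges v p2 = edges v c ++ (last s a, w) :: edges w d by rewrite Ecd edges_cat /= lc.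
(* The common edge lies on the representative, hence outside [X], hence not among the last [k] edges
   of [p2]: at least [k] edges follow it. *)
have kd : k <= size d.
  rewrite leqNgt; apply/negP => dk; have := avoidsP _ _ rX _ eaw; case/negP.
  have -> : X = drop (size p2 - k) (edges v p2).
    rewrite {2}Ep2 edges_cat drop_size_cat // size_edges size_takel //; exact: leq_subr.
  rewrite Ecde drop_cat size_edges Ecd size_cat /=.
  case: ltnP => _; first by rewrite mem_cat inE eqxx orbT.
  have -> : size c + (size d).+1 - k - size c = 0 by clear -dk; lia.
  by rewrite drop0 mem_head.
have ta : trail s a by move: tp1'; rewrite Ep1' trail_cat => /andP [].
move: tp2; rewrite {1}Ecd trail_cat lc => /and3P [tc twd _].
(* The new trail follows the representative up to its first edge on [p2] and continues along [p2].
   It is shorter because [a] has fewer than the [k] edges of [p1]. *)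
have := IHm (a ++ w :: d); case.
- have : size a < k by rewrite -sp1' Ep1' size_cat /= addnS ltnS leq_addr.
  by move: pm; rewrite Ep Ecd !size_cat /= sp1; clear; lia.
- rewrite trail_cat ta twd !andTb; apply: contra ndis => /hasP [f fw fa]; apply/hasP; exists f => //.
  by rewrite /= Ecd edges_cat lc mem_cat fw orbT.
- by rewrite size_cat /= addnS; apply: leqW; apply: leq_trans kd (leq_addl _ _).
move=> r' [p' [r'R pp' lp']]; exists r', p'; split=> //.
by rewrite lp' Ep Ecd !last_cat.
Qed.

Lemma exact_correct k q s t : k <= q ->
  has (fun r => r.1 == t) (representatives n e k q s k) <-> exists p, [/\ trail s p, last s p = t & size p = k].
Proof.
move=> kq; split=> [/hasP [r /representatives_sound [p [tp lp _ sp]] /eqP <-]|[p [tp <- sp]]].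
  by exists p.
have [|r [rR rt _]] := representatives_complete (X := [::]) kq (leqnn k) tp sp kq; first exact/avoidsP.
by apply/hasP; exists r => //; rewrite rt.
Qed.

(** A walk of at most [k] edges shortens to a trail without becoming longer, so walks decide the
    question. *)
Lemma atmost_correct k s t : s < n ->
  t \in reach n e [::] k s <-> exists p, [/\ trail s p, last s p = t & size p <= k].
Proof.
move=> sn; split=> [/(reachP _ _ _ sn) [p [pp <- sp]]|[p [/andP [pp _] lp sp]]].
  have [|p' [tp' _ lp' _ sp']] := trail_path pp; first by move=> u v /andP [].
  by exists p'; split=> //; exact: leq_trans sp.
apply/(reachP _ _ _ sn); exists p; split=> //; by apply: sub_path pp => u v /= ->.
Qed.

Lemma atleast_correct k q s t : s < n -> k + k <= q ->
  has (fun r => t \in reach n e r.2 n r.1) (representatives n e k q s k) <->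
  exists p, [/\ trail s p, last s p = t & k <= size p].
Proof.
move=> sn kq.
have vert p v : v < n -> path e v p -> all (fun u => u < n) (v :: p).
  by elim: p v => [|w p IH] v /= -> //= /andP [/e_lt /andP [_ wn] /IH]; apply.
split=> [/hasP [r rR tr]|[p [tp <- kp]]].
  have [p [tp lp Er sp]] := representatives_sound rR.
  have rn : r.1 < n.
    have /andP [pp _] := tp; have /allP := vert _ _ sn pp; apply; rewrite -lp; exact: mem_last.
  have [p1 [pp1 lp1 _]] := reachP _ _ _ rn tr.
  have [|p2 [tp2 pp2 lp2 _ _]] := trail_path pp1; first by move=> u v /andP [].
  exists (p ++ p2); split; last by rewrite size_cat sp leq_addr.
    rewrite trail_cat tp lp tp2 /= -[edges s p]revK -Er.
    elim: p2 (r.1) pp2 {tp2 lp2} => [|w p2 IH] u //= /andP [/andP [_ nin] /IH H].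
    by rewrite negb_or mem_rev nin.
  by rewrite last_cat lp lp2.
have [r [p' [rR pp' lp']]] := representatives_atleast kq tp kp.
apply/hasP; exists r => //.
have [p1 [tp1 lp1 Er sp1]] := representatives_sound rR.
have rn : r.1 < n.
  have /andP [pp _] := tp1; have /allP := vert _ _ sn pp; apply; rewrite -lp1; exact: mem_last.
(* Distinct vertices below [n] leave room for fewer than [n] edges, so [n] rounds of [reach]
   suffice. *)
have [|p2 [tp2 pp2 lp2 up2 _]] := trail_path pp'; first by move=> u v /andP [].
apply/(reachP _ _ _ rn); exists p2; split=> //; first by rewrite lp2.
have /andP [pp _] := tp2; have /allP H := vert _ _ rn pp.
have : size (r.1 :: p2) <= size (iota 0 n).
  by apply: uniq_leq_size => // x /H; rewrite mem_iota.
by rewrite size_iota => /ltnW.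
Qed.

End Trails.

(** * The trail procedures in polynomial time *)

Section Curried.
Context (X A B : code).

Lemma pt_map_fun (l : X -> seq A) (f : X -> A -> B) :
  PT l -> PT (fun z : X * A => f z.1 z.2) -> PT (fun x => map (f x) (l x)).
Proof. exact: pt_map. Qed.
Lemma pt_filter_fun (l : X -> seq A) (p : X -> A -> bool) :
  PT l -> PT (fun z : X * A => p z.1 z.2) -> PT (fun x => filter (p x) (l x)).
Proof. exact: pt_filter. Qed.
Lemma pt_has_fun (l : X -> seq A) (p : X -> A -> bool) :
  PT l -> PT (fun z : X * A => p z.1 z.2) -> PT (fun x => has (p x) (l x)).
Proof. exact: pt_has. Qed.
Lemma pt_iter_fun (n : X -> nat) (f : X -> B -> B) (b : X -> B) g :
  PT n -> PT (fun z : X * B => f z.1 z.2) -> PT b -> poly_bounded g ->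
  (forall x i, i <= n x -> meas (iter i (f x) (b x)) <= g x) -> PT (fun x => iter (n x) (f x) (b x)).
Proof. exact: pt_iter. Qed.
End Curried.

Lemma pt_take (X A : code) (n : X -> nat) (l : X -> seq A) : PT n -> PT l -> PT (fun x => take (n x) (l x)).
Proof.
move=> Hn Hl; apply: pt_ext (pt_rev (pt_drop (pt_subn (pt_size Hl) Hn) (pt_rev Hl))) => x.
rewrite drop_rev revK; case: (leqP (n x) (size (l x))) => le; first by rewrite subKn.
by rewrite !take_oversize ?(ltnW le) //; lia.
Qed.

Lemma pt_const (X : code) (n : nat) : PT (fun x : X => n).
Proof. by elim: n => [|n IH]; [exact: pt_0 | exact: pt_succ]. Qed.

Lemma pt_muln (X : code) (m n : X -> nat) : PT m -> PT n -> PT (fun x => m x * n x).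
Proof.
move=> Hm Hn; have it x i : iter i (addn (n x)) 0 = i * n x by elim: i => [|i IH] //=; rewrite IH mulSn.
apply: (pt_ext (f := fun x => iter (m x) (addn (n x)) 0)); first by move=> x; exact: it.
apply: (@pt_iter_fun X code_nat m (fun x => addn (n x)) (fun=> 0) (fun x => 2 * (m x * n x) + 2)) => //.
- by apply: pt_addn; [apply: (pt_comp Hn); exact: pt_fst | exact: pt_snd].
- exact: pt_0.
- by have Mm := poly_nat Hm; have Mn := poly_nat Hn; pbound.
move=> x i le; rewrite it /= -mul2n; have : i * n x <= m x * n x by rewrite leq_mul2r le orbT.
lia.
Qed.

Lemma pt_mem_nat (X : code) (n : X -> nat) (l : X -> seq nat) : PT n -> PT l -> PT (fun x => n x \in l x).
Proof.
move=> Hn Hl; apply: (pt_ext (f := fun x => has (fun a => n x == a) (l x))).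
  by move=> x; rewrite -has_pred1; apply: eq_has => a; rewrite /= eq_sym.
apply: (@pt_has_fun X code_nat) => //.
by apply: pt_eqn; [apply: (pt_comp Hn); exact: pt_fst | exact: pt_snd].
Qed.

Lemma pt_weaken (Z X A : code) (h : Z -> X) (f : X -> A) : PT f -> PT h -> PT (fun z => f (h z)).
Proof. exact: pt_comp. Qed.

Lemma pt_mem_edge (X : code) (e : X -> edge) (F : X -> seq edge) : PT e -> PT F -> PT (fun x => mem_edge (e x) (F x)).
Proof.
move=> He HF; apply: (@pt_has_fun X (code_prod code_nat code_nat)) => //.
by apply: pt_and; apply: pt_eqn; do [apply: pt_fst_of | apply: pt_snd_of];
  do [exact: pt_snd | apply: (pt_weaken He); exact: pt_fst].
Qed.

Lemma pt_avoids (X : code) (F T : X -> seq edge) : PT F -> PT T -> PT (fun x => avoids (F x) (T x)).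
Proof.
move=> HF HT; apply: pt_neg; apply: (@pt_has_fun X (code_prod code_nat code_nat)) => //.
by apply: pt_mem_edge; [exact: pt_snd | apply: (pt_weaken HF); exact: pt_fst].
Qed.

Lemma pt_first_avoiding (X : code) (C : X -> seq (seq edge)) (F : X -> seq edge) :
  PT C -> PT F -> PT (fun x => first_avoiding (C x) (F x)).
Proof.
move=> HC HF; apply: pt_take; first exact: pt_const.
apply: (@pt_filter_fun X (code_seq (code_prod code_nat code_nat))) => //.
by apply: pt_avoids; [apply: (pt_weaken HF); exact: pt_fst | exact: pt_snd].
Qed.

Ltac pt := repeat first [assumption | lazymatch goal with
  | |- @PT ?X ?A ?F => lazymatch F with
    | (fun x => x) => exact: pt_id
    | (fun x => (@?f x, @?g x)) => apply: pt_pair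
    | (fun x => fst (@?f x)) => apply: pt_fst_of
    | (fun x => snd (@?f x)) => apply: pt_snd_of
    | @snd _ _ => exact: pt_snd
    | @fst _ _ => exact: pt_fst
    | (fun x => nil) => exact: pt_nil
    | (fun x => cons (@?f x) (@?g x)) => apply: pt_cons_of
    | (fun x => cat (@?f x) (@?g x)) => apply: pt_cat
    | (fun x => map (@?f x) (@?g x)) => apply: pt_map_fun
    | (fun x => filter (@?f x) (@?g x)) => apply: pt_filter_fun
    | (fun x => has (@?f x) (@?g x)) => apply: pt_has_fun
    | (fun x => flatten (@?f x)) => apply: pt_flatten
    | (fun x => take (@?f x) (@?g x)) => apply: pt_take
    | (fun x => drop (@?f x) (@?g x)) => apply: pt_drop
    | (fun x => nth (@?d x) (@?f x) (@?g x)) => apply: pt_nth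
    | (fun x => size (@?f x)) => apply: pt_size
    | (fun x => iota 0 (@?f x)) => apply: pt_iota0
    | (fun x => true) => exact: pt_true
    | (fun x => false) => exact: pt_false
    | (fun x => ~~ (@?f x)) => apply: pt_neg
    | (fun x => (@?f x) && (@?g x)) => apply: pt_and
    | (fun x => (@?f x) || (@?g x)) => apply: pt_or
    | (fun x => (@?f x) + (@?g x)) => apply: pt_addn
    | (fun x => (@?f x) * (@?g x)) => apply: pt_muln
    | (fun x => (@?f x) - (@?g x)) => apply: pt_subn
    | (fun x => (@?f x) <= (@?g x)) => apply: pt_leq
    | (fun x => (@?f x) == (@?g x)) => apply: pt_eqn
    | (fun x => (@?f x) \in (@?g x)) => apply: pt_mem_nat
    | (fun x => S (@?f x)) => apply: pt_succ
    | (fun x => O) => exact: pt_0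
    | (fun x => mem_edge (@?f x) (@?g x)) => apply: pt_mem_edge
    | (fun x => avoids (@?f x) (@?g x)) => apply: pt_avoids
    | (fun x => first_avoiding (@?f x) (@?g x)) => apply: pt_first_avoiding
    | (fun x => ?h (@?f x)) => match goal with H : @PT _ _ h |- _ => apply: (pt_weaken H) end
    end
  end].

Lemma pt_branch (X : code) (k : X -> nat) (C : X -> seq (seq edge)) st :
  PT k -> PT C -> PT st -> PT (fun x => branch (k x) (C x) (st x)).
Proof. by move=> Hk HC Hst; rewrite /branch; pt. Qed.

Lemma meas_seq_le (A : code) (l : seq A) M : all (fun a => meas a <= M) l -> meas l <= size l * M + 2.
Proof. by elim: l => [|a l IH] //= /andP [le /IH]; rewrite mulSn -addnA; exact: leq_add. Qed.

Lemma meas_elem (A : code) (l : seq A) : all (fun a => meas a <= meas l) l.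
Proof.
elim: l => [|a l IH] //=; rewrite leq_addr /=; apply: sub_all IH => b le.
by apply: leq_trans le _; exact: leq_addl.
Qed.

Lemma size_flatten_le (A B : Type) (g : A -> seq B) l c : (forall a, size (g a) <= c) ->
  size (flatten (map g l)) <= size l * c.
Proof. by move=> H; elim: l => [|a l IH] //=; rewrite size_cat mulSn leq_add. Qed.

Lemma size_first_avoiding C F : size (first_avoiding C F) <= 1.
Proof. by rewrite /first_avoiding size_take; case: ltnP. Qed.

(** A round replaces each guess by at most [k] guesses with one more edge from a member of [C] and
    selects at most one member per guess. Apart from the powers of [k.+1] all growth is linear in
    [j]; the base [k.+1] keeps the powers positive and monotone. *)
Lemma branch_sizes k q C j : j <= q.+1 -> let st := iter j (branch k C) ([:: [::]], [::]) in
  [/\ size st.1 <= k.+1 ^ j, forall F, F \in st.1 -> meas F <= 2 + j * meas C,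
      size st.2 <= j * k.+1 ^ q.+1 & forall T, T \in st.2 -> meas T <= meas C].
Proof.
elim: j => [|j IH] lej; first by split=> // F; rewrite inE => /eqP ->.
rewrite iterS; set st := iter j _ _ in IH *.
have memC T : T \in C -> meas T <= meas C by move=> TC; have /allP := meas_elem C; exact.
have memT (e : edge) (T : seq edge) : e \in T -> meas e <= meas T by move=> eT; have /allP := meas_elem T; exact.
have [s1 m1 s2 m2] := IH (ltnW lej); split=> /=.
- apply: (@leq_trans (size st.1 * k.+1)); last by rewrite expnSr leq_mul2r s1 orbT.
  apply: size_flatten_le => F; apply: (@leq_trans (1 * k.+1)); last by rewrite mul1n.
  apply: (@leq_trans (size (first_avoiding C F) * k.+1)); last by rewrite leq_mul2r size_first_avoiding orbT.
  apply: size_flatten_le => T; rewrite size_map size_take; case: ltnP => H; first exact: leqnSn.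
  by apply: leq_trans H (leqnSn _).
- move=> F' /flatten_mapP [F /m1 FC /flatten_mapP [T /first_avoiding_sub /memC TC /mapP [e /mem_take /memT eT ->]]].
  rewrite mulSn addnCA; apply: leq_add FC; exact: leq_trans eT TC.
- rewrite size_cat mulSn; apply: leq_add s2; apply: (@leq_trans (size st.1 * 1)).
    by apply: size_flatten_le => F; exact: size_first_avoiding.
  by rewrite muln1; apply: leq_trans s1 _; apply: leq_pexp2l => //; exact: ltnW.
- by move=> T; rewrite mem_cat => /orP [/flatten_mapP [F _ /first_avoiding_sub /memC]|/m2].
Qed.

Lemma size_reduce k q C : size (reduce k q C) <= q.+1 * k.+1 ^ q.+1.
Proof. by case: (@branch_sizes k q C q.+1 (leqnn _)) => _ _ H _; exact: H. Qed.

(** The search tree has exponential size; the hypothesis on the power asks the measure of [x] to pay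
    for it, which is where the parameter enters the time bound. *)
Lemma pt_reduce (X : code) (k q : X -> nat) (C : X -> seq (seq edge)) :
  PT k -> PT q -> PT C -> poly_bounded (fun x => (k x).+1 ^ (q x).+1) ->
  PT (fun x => reduce (k x) (q x) (C x)).
Proof.
move=> Hk Hq HC HB; rewrite /reduce; apply: pt_snd_of.
pose B x := (k x).+1 ^ (q x).+1.
pose g x := B x * (2 + (q x).+1 * meas (C x)) + 2 + ((q x).+1 * B x * meas (C x) + 2).
apply: (@pt_iter_fun X (code_prod (code_seq (code_seq (code_prod code_nat code_nat)))
   (code_seq (code_seq (code_prod code_nat code_nat)))) (fun x => (q x).+1) (fun x => branch (k x) (C x))
   (fun=> ([:: [::]], [::])) g).
- by pt.
- by apply: pt_branch; pt.
- by pt.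
- have Mq := poly_nat Hq; have MC := pt_meas HC; by rewrite /g /B; pbound.
move=> x i le; have [s1 m1 s2 m2] := @branch_sizes (k x) (q x) (C x) i le.
set st := iter _ _ _ in s1 m1 s2 m2 *.
apply: (@leq_trans (meas st.1 + meas st.2)) => //; apply: leq_add.
  apply: (@leq_trans (size st.1 * (2 + i * meas (C x)) + 2)).
    by apply: meas_seq_le; apply/allP.
  rewrite leq_add2r; apply: leq_mul; last by rewrite leq_add2l leq_mul2r le orbT.
  by apply: leq_trans s1 _; rewrite /B; exact: leq_pexp2l.
apply: (@leq_trans (size st.2 * meas (C x) + 2)).
  by apply: meas_seq_le; apply/allP.
rewrite leq_add2r leq_mul2r; apply/orP; right; apply: leq_trans s2 _.
by rewrite leq_mul2r le orbT.
Qed.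

Lemma pt_candidates (X : code) (e : X -> rel nat) (R : X -> seq (nat * seq edge)) (v : X -> nat) :
  PT (fun z : X * (nat * nat) => e z.1 z.2.1 z.2.2) -> PT R -> PT v ->
  PT (fun x => candidates (e x) (R x) (v x)).
Proof.
move=> He HR Hv; rewrite /candidates; pt.
by apply: (pt_comp (f := fun z => (z.1, (z.2.1, v z.1))) He); pt.
Qed.

Section Representatives.
Context (X : code) (n k q s : X -> nat) (e : X -> rel nat).
Hypotheses (Hn : PT n) (Hk : PT k) (Hq : PT q) (Hs : PT s)
  (He : PT (fun z : X * (nat * nat) => e z.1 z.2.1 z.2.2))
  (HB : poly_bounded (fun x => (k x).+1 ^ (q x).+1))
  (e_lt : forall x u v, e x u v -> (u < n x) && (v < n x)) (s_lt : forall x, s x < n x).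

Lemma pt_extend (R : X -> seq (nat * seq edge)) : PT R ->
  PT (fun x => extend (n x) (e x) (k x) (q x) (R x)).
Proof.
move=> HR; rewrite /extend; pt.
apply: (@pt_reduce (code_prod X code_nat) (fun z => k z.1) (fun z => q z.1)
  (fun z => candidates (e z.1) (R z.1) z.2)); pt.
  apply: (@pt_candidates (code_prod X code_nat) (fun z => e z.1)); pt.
  by apply: (pt_comp (f := fun z => (z.1.1, (z.2.1, z.2.2))) He); pt.
by apply: poly_comp HB; apply: (pt_meas (@pt_fst _ _)).
Qed.
End Representatives.

Lemma size_extend n e k q R : size (extend n e k q R) <= n * (q.+1 * k.+1 ^ q.+1).
Proof.
rewrite /extend -[X in X * _](size_iota 0 n); apply: size_flatten_le => v.
by rewrite size_map size_reduce.
Qed.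

Lemma path_lt n (e : rel nat) (e_lt : forall u v, e u v -> (u < n) && (v < n)) p v :
  v < n -> path e v p -> all (fun u => u < n) (v :: p).
Proof. by elim: p v => [|w p IH] v /= -> //= /andP [/e_lt /andP [_ wn] /IH]; apply. Qed.

(** Each family after the first is already reduced, so its size does not accumulate over the rounds;
    its members have at most [k] edges, each of measure at most [4 * n + 4]. *)
Lemma meas_representatives n (e : rel nat) k q s i : (forall u v, e u v -> (u < n) && (v < n)) -> s < n -> i <= k ->
  meas (representatives n e k q s i) <=
    (1 + n * (q.+1 * k.+1 ^ q.+1)) * (2 * n + 2 + (k * (4 * n + 4) + 2)) + 2.
Proof.
move=> e_lt sn ik; apply: leq_trans (meas_seq_le (M := 2 * n + 2 + (k * (4 * n + 4) + 2)) _) _; last first.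
  rewrite leq_add2r leq_mul2r; apply/orP; right.
  by case: i ik => [|i] _; [rewrite /= | apply: leq_trans (size_extend _ _ _ _ _) _; exact: leq_addl].
apply/allP => r /representatives_sound [p [/andP [pp _] lp Er sp]].
have /allP plt := path_lt e_lt sn pp.
have rn : r.1 < n by apply: plt; rewrite -lp; exact: mem_last.
apply: (@leq_trans (meas r.1 + meas r.2)) => //; apply: leq_add; first by rewrite /= -mul2n addn2 !ltnS leq_mul2l; exact: ltnW.
apply: leq_trans (meas_seq_le (M := 4 * n + 4) _) _; last first.
  by rewrite leq_add2r leq_mul2r Er size_rev size_edges sp ik orbT.
rewrite Er all_rev; elim: p s {sn lp Er sp rn pp} plt => [|v p IH] s plt //=.
rewrite IH ?andbT; last by move=> x xp; apply: plt; rewrite inE xp orbT.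
have := plt s; have := plt v; rewrite !inE !eqxx orbT => /(_ isT) vn /(_ isT) sn.
by clear -vn sn; lia.
Qed.

Lemma pt_representatives (X : code) (n k q s : X -> nat) (e : X -> rel nat) :
  PT n -> PT k -> PT q -> PT s -> PT (fun z : X * (nat * nat) => e z.1 z.2.1 z.2.2) ->
  poly_bounded (fun x => (k x).+1 ^ (q x).+1) ->
  (forall x u v, e x u v -> (u < n x) && (v < n x)) -> (forall x, s x < n x) ->
  PT (fun x => representatives (n x) (e x) (k x) (q x) (s x) (k x)).
Proof.
move=> Hn Hk Hq Hs He HB e_lt s_lt; rewrite /representatives.
pose R := code_seq (code_prod code_nat (code_seq (code_prod code_nat code_nat))).
apply: (@pt_iter_fun X R k (fun x => extend (n x) (e x) (k x) (q x)) (fun x => [:: (s x, [::])]) (fun x =>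
  (1 + n x * ((q x).+1 * (k x).+1 ^ (q x).+1)) * (2 * n x + 2 + (k x * (4 * n x + 4) + 2)) + 2)) => //.
- apply: (@pt_extend (code_prod X R) (fun z => n z.1) (fun z => k z.1) (fun z => q z.1) (fun z => e z.1)); pt.
    by apply: (pt_comp (f := fun z => (z.1.1, (z.2.1, z.2.2))) He); pt.
  by apply: poly_comp HB; apply: (pt_meas (@pt_fst _ _)).
- by pt.
- have Mn := poly_nat Hn; have Mk := poly_nat Hk; have Mq := poly_nat Hq; pbound.
by move=> x i ik; exact: (@meas_representatives (n x) (e x) (k x) (q x) (s x) i (e_lt x) (s_lt x) ik).
Qed.

Lemma meas_filter (A : code) p (l : seq A) : meas (filter p l) <= meas l.
Proof.
elim: l => [|a l IH] //=; case: ifP => _ /=; first by rewrite leq_add2l; exact: IH.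
by apply: leq_trans IH (leq_addl _ _).
Qed.

(** After every round the set is a sublist of [iota 0 n], which bounds all iterates. *)
Lemma pt_reach (X : code) (n m s : X -> nat) (e : X -> rel nat) (F : X -> seq edge) :
  PT n -> PT m -> PT s -> PT F -> PT (fun z : X * (nat * nat) => e z.1 z.2.1 z.2.2) ->
  PT (fun x => reach (n x) (e x) (F x) (m x) (s x)).
Proof.
move=> Hn Hm Hs HF He; rewrite /reach.
apply: (@pt_iter_fun X (code_seq code_nat) m (fun x => spread (n x) (e x) (F x)) (fun x => [:: s x]) (fun x =>
  meas (iota 0 (n x)) + meas [:: s x])) => //.
- rewrite /spread; pt.
  by apply: (pt_comp (f := fun z => (z.1.1.1, (z.2, z.1.2))) He); pt.
- by pt.
- have M1 := pt_meas (pt_iota0 Hn); have M2 : poly_bounded (fun x : X => meas [:: s x]) by apply: pt_meas; pt.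
  by pbound.
move=> x [|i] _; first exact: leq_addl.
apply: leq_trans (leq_addr _ _); rewrite iterS /spread.
exact: meas_filter.
Qed.

(** * Unary numbers in the input and computability of the parameter bound *)

Lemma pt_find_false (X : code) (w : X -> seq bool) : PT w -> PT (fun x => find negb (w x)).
Proof.
(* The flag stays [true] while the leading run of ones lasts. *)
move=> Hw; pose F (st : nat * bool) b := if st.2 && b then (st.1.+1, true) else (st.1, false).
have FE st w' : foldl F st w' = (if st.2 then st.1 + find negb w' else st.1, st.2 && ~~ has negb w').
  elim: w' st => [|b w' IH] [a []] //=; rewrite ?addn0 // IH /=.
  by case: b => //=; rewrite ?addn0 // addSnnS.
apply: (pt_ext (f := fun x => (foldl F (0, true) (w x)).1)); first by move=> x; rewrite FE.
apply: pt_fst_of.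
apply: (@pt_foldl_additive X code_bool (code_prod code_nat code_bool) w (fun z => F z.2.1 z.2.2) (fun=> (0, true)) (fun=> 2)) => //.
- by rewrite /F; apply: pt_if; pt.
- by pt.
- by pbound.
by move=> x [a b] c _ /=; rewrite /F /=; case: ifP => _ /=; lia.
Qed.

Lemma find_nseq_true n r : find negb (nseq n true ++ false :: r) = n.
Proof. by elim: n => [|n IH] //=; rewrite IH. Qed.

Lemma pt_expn (X : code) (m n : X -> nat) : PT m -> PT n -> poly_bounded (fun x => m x ^ n x) ->
  PT (fun x => m x ^ n x).
Proof.
move=> Hm Hn HB; have it x i : iter i (muln (m x)) 1 = m x ^ i by elim: i => [|i IH] //=; rewrite IH expnS.
apply: (pt_ext (f := fun x => iter (n x) (muln (m x)) 1)); first by move=> x; exact: it.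
apply: (@pt_iter_fun X code_nat n (fun x => muln (m x)) (fun=> 1) (fun x => 2 * (m x ^ n x + 1) + 2)) => //.
- by pt.
- by pt.
- by pbound.
move=> x i le; rewrite it /= -mul2n -addn2 leq_add2r leq_mul2l /=.
case: (posnP (m x)) => [->|m0]; first by case: (i) => [|j]; [exact: leq_addl | rewrite exp0n].

by apply: leq_trans (leq_addr _ _); exact: leq_pexp2l.
Qed.

Lemma pt_exp_const (X : code) (m : X -> nat) (c : nat) : PT m -> PT (fun x => m x ^ c).
Proof.
move=> Hm; elim: c => [|c IH]; first exact: pt_const.
by apply: (pt_ext (f := fun x => m x * m x ^ c)); [move=> x; rewrite expnS | exact: pt_muln].
Qed.

Lemma meas_bits (w : seq bool) : meas w = 4 * size w + 2.
Proof. by elim: w => [|b w IH] //=; rewrite -/(meas w) IH; lia. Qed.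

Definition branching k := k.+1 ^ (k + k).+1.

Lemma counted_lt (w : seq bool) : tsz (enc w) < meas w + branching (find negb w).
Proof. by apply: leq_trans (tsz_lt_meas w) (leq_addr _ _). Qed.
(* Bit strings measured so that values of [branching] at the leading unary number are polynomial. *)
Definition counted : code := Code counted_lt.

Lemma pt_counted : PT (fun w : counted => w : seq bool).
Proof.
exists Id; split=> //=; first by pbound.
by apply: (poly_le (@poly_meas counted)) => w; exact: leq_addr.
Qed.

Lemma all_true_nseq (w : seq bool) : ~~ has negb w -> w = nseq (size w) true.
Proof. by elim: w => [|[] w IH] //= /IH {1}->. Qed.

Lemma leading_true w : find negb w < size w ->
  w = nseq (find negb w) true ++ false :: drop (find negb w).+1 w.
Proof. by elim: w => [|[] w IH] //=; rewrite ?drop0 // ltnS => /IH {1}->. Qed.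

(** Deciding the graph of the function asks for no time bound. The measure of [counted] makes
    [branching] admissible, so the closure properties yield a total program, and only its
    correctness is used. *)
Lemma computable_bound a b c d : computable_fun (fun k => (a * (branching k + b) ^ c) ^ d).
Proof.
set f := fun k => _.
pose test (w : seq bool) := (find negb w < size w) && (~~ has negb (drop (find negb w).+1 w) &&
  (f (find negb w) == size (drop (find negb w).+1 w))).
have Pw := pt_counted; have Pk := @pt_find_false counted _ Pw.
have PB : PT (fun w : counted => branching (find negb w)).
  apply: (@pt_expn counted (fun w => (find negb w).+1) (fun w => (find negb w + find negb w).+1)).
  - exact: pt_succ.
  - by apply: pt_succ; exact: pt_addn.
  by apply: (poly_le (@poly_meas counted)) => w; exact: leq_addl.
have Pf : PT (fun w : counted => f (find negb w)).
  apply: (@pt_exp_const counted (fun w => a * (branching (find negb w) + b) ^ c)).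
  apply: pt_muln; first exact: pt_const.
  apply: (@pt_exp_const counted (fun w => branching (find negb w) + b)).
  by apply: pt_addn => //; exact: pt_const.
have Pd : PT (fun w : counted => drop (find negb w).+1 w) by apply: pt_drop => //; exact: pt_succ.
have : PT (fun w : counted => test w).
  apply: pt_and; first by apply: pt_leq; [exact: pt_succ | exact: pt_size].
  apply: pt_and; last by apply: pt_eqn => //; exact: pt_size.
  apply: pt_neg; apply: (@pt_has_fun counted code_bool _ (fun=> negb)) => //.
  by apply: pt_neg; exact: pt_snd.
case=> p [p1 _ _]; exists (machine p) => w.
have [halted acc] := machine_correct (p := p) (w := w) (leqnn _).
eexists; split; first exact: halted.
apply: (iff_trans acc); rewrite -[enc_seq enc_bool w]/(@enc counted w) p1.
split=> [|[k [m [-> fk]]]].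
  case E: (test w) => // _; move: E => /and3P [lt nh /eqP fE].
  exists (find negb w), (size (drop (find negb w).+1 w)); split=> //.
  by rewrite -all_true_nseq // -leading_true.
(* The extra 1 in [k.+1] removes the separating [false]. *)
have dr : drop k.+1 (nseq k true ++ false :: nseq m true) = nseq m true.
  by rewrite -cat_rcons drop_size_cat // size_rcons size_nseq.
have -> : test (nseq k true ++ false :: nseq m true) => //.
rewrite /test find_nseq_true dr size_cat !size_nseq /= size_nseq fk eqxx andbT.
rewrite addnS ltnS leq_addr /=.
by elim: m {fk dr} => [|m IH].
Qed.

(** * Instances *)

Record instance := Instance {
  order : nat;
  adjacent : rel 'I_order;
  source : 'I_order;
  target : 'I_order;
  param : nat }.

Definition bits x := enc_instance (@adjacent x) (source x) (target x) (param x).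

Lemma enc_instance_lt x : tsz (enc (bits x)) < meas (bits x) + branching (param x).
Proof. by apply: leq_trans (tsz_lt_meas (bits x)) (leq_addr _ _). Qed.
Definition code_instance : code := Code enc_instance_lt.

Lemma pt_bits : PT (fun x : code_instance => bits x).
Proof.
exists Id; split=> //=; first by pbound.
by apply: (poly_le (@poly_meas code_instance)) => w; exact: leq_addr.
Qed.

Lemma size_bits_ge2 x : 2 <= size (bits x).
Proof.
rewrite /bits /enc_instance !size_cat /= !size_cat /= !size_nseq.
by have := ltn_ord (source x); clear; lia.
Qed.

(* The measure is linear in the size of the input and polynomial in [branching], so any running
   time polynomial in it has the fixed-parameter form. *)
Lemma FPT_of_pt (P : trail_problem) (f : instance -> bool) :
  @PT code_instance code_bool f ->
  (forall x, f x <-> P (order x) (@adjacent x) (source x) (target x) (param x)) -> FPT P.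
Proof.
case=> p [p1 [c p2] _] fP.
(* The measure [4 * size w + 2 + branching k] is at most [y = (branching k + 6) * size w]. Both
   [(size w).+1] and the cost are at most [y ^ c.+1], the exponent [c.+1] covering the case [c = 0];
   together they double the factor 200, and the square is that of [machine_correct]. *)
exists (machine p), (fun k => (400 * (branching k + 6) ^ c.+1) ^ 2), (c.+1 * 2); split.
  exact: computable_bound.
move=> n E s t k w cf; pose x := Instance E s t k.
have [|halted acc] := @machine_correct p w ((400 * (branching k + 6) ^ c.+1) ^ 2 * size w ^ (c.+1 * 2)).
  rewrite expnM -expnMn leq_exp2r // -mulnA -expnMn.
  have w2 : 2 <= size w := size_bits_ge2 x.
  set y := (branching k + 6) * size w.
  have My : meas (x : code_instance) <= y.
    rewrite /= meas_bits -[size (bits x)]/(size w) /y mulnDl.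
    have : branching k * 1 <= branching k * size w by rewrite leq_mul2l; apply/orP; right; apply: ltnW.
    by rewrite muln1 /=; set Bw := _ * size w; clear -w2; lia.
  have wy : (size w).+1 <= y ^ c.+1.
    apply: (@leq_trans y); first by rewrite /y mulnDl; clear -w2; lia.
    by rewrite -{1}[y]expn1 leq_pexp2l // /y muln_gt0; clear -w2; lia.
  have py : fcost p (enc_seq enc_bool w) <= y ^ c.+1.
    apply: leq_trans (p2 x) _; apply: leq_trans (leq_pexp2l _ (leqnSn c)) _; first exact: ltnW (meas_ge2 _).
    by rewrite leq_exp2r.
  clear -wy py; lia.
split=> //; apply: (iff_trans acc); apply: (iff_trans _ (fP x)).
rewrite -[enc_seq enc_bool w]/(enc (x : code_instance)) p1.
by case: (f x).
Qed.

(** * Decoding an instance *)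

Section Decoding.
Let w1 x := drop (order x).+1 (bits x).
Let w2 x := drop (order x * order x) (w1 x).
Let w3 x := drop (source x).+1 (w2 x).

(** A lookup in the adjacency matrix stored row by row. Without the bounds an index could spill into
    the next row or into the codes of [s], [t] and [k] behind the matrix. *)
Definition edge_rel x (u v : nat) := [&& u < order x, v < order x & nth false (w1 x) (u * order x + v)].

Lemma drop_nseq_true n r : drop n.+1 (nseq n true ++ false :: r) = r.
Proof. by rewrite -cat_rcons drop_size_cat // size_rcons size_nseq. Qed.

Let w1E x : w1 x = [seq adjacent i j | i <- enum 'I_(order x), j <- enum 'I_(order x)] ++
  nseq (source x) true ++ false :: nseq (target x) true ++ false :: nseq (param x) true.
Proof. exact: drop_nseq_true. Qed.

Let w2E x : w2 x = nseq (source x) true ++ false :: nseq (target x) true ++ false :: nseq (param x) true.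
Proof. by rewrite /w2 w1E drop_size_cat // size_allpairs !size_enum_ord. Qed.

Let w3E x : w3 x = nseq (target x) true ++ false :: nseq (param x) true.
Proof. by rewrite /w3 w2E drop_nseq_true. Qed.

Lemma nth_allpairs (A B : Type) (C : Type) (f : A -> B -> C) (a0 : A) (b0 : B) (c0 : C) s t i j r :
  i < size s -> j < size t ->
  nth c0 ([seq f a b | a <- s, b <- t] ++ r) (i * size t + j) = f (nth a0 s i) (nth b0 t j).
Proof.
elim: s i => [|a s IH] [|i] //= lti ltj; rewrite -catA nth_cat size_map.
  by rewrite mul0n ltj (nth_map b0).
by rewrite mulSn -addnA ltnNge leq_addr /= addKn IH.
Qed.

Lemma edge_rel_ord x (i j : 'I_(order x)) : edge_rel x i j = adjacent i j.
Proof.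
rewrite /edge_rel !ltn_ord w1E /=.
have := @nth_allpairs _ _ _ (@adjacent x) i j false (enum 'I_(order x)) (enum 'I_(order x)) i j.
by rewrite size_enum_ord => ->; rewrite ?ltn_ord // !nth_ord_enum.
Qed.

Lemma edge_rel_lt x u v : edge_rel x u v -> (u < order x) && (v < order x).
Proof. by case/and3P => -> ->. Qed.

Lemma pt_order : PT (fun x : code_instance => order x).
Proof.
by apply: pt_ext (pt_find_false pt_bits) => x; exact: find_nseq_true.
Qed.

Let pt_w1 : PT (fun x : code_instance => w1 x).
Proof. by apply: pt_drop pt_bits; apply: pt_succ; exact: pt_order. Qed.

Let pt_w2 : PT (fun x : code_instance => w2 x).
Proof. by apply: pt_drop pt_w1; apply: pt_muln; exact: pt_order. Qed.

Lemma pt_source : PT (fun x : code_instance => source x : nat).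
Proof. by apply: pt_ext (pt_find_false pt_w2) => x; rewrite w2E find_nseq_true. Qed.

Let pt_w3 : PT (fun x : code_instance => w3 x).
Proof. by apply: pt_drop pt_w2; apply: pt_succ; exact: pt_source. Qed.

Lemma pt_target : PT (fun x : code_instance => target x : nat).
Proof. by apply: pt_ext (pt_find_false pt_w3) => x; rewrite w3E find_nseq_true. Qed.

Lemma pt_param : PT (fun x : code_instance => param x).
Proof.
apply: pt_ext (pt_size (pt_drop (pt_succ pt_target) pt_w3)) => x.
by rewrite w3E drop_nseq_true size_nseq.
Qed.

Lemma pt_edge_rel : PT (fun z : code_instance * (nat * nat) => edge_rel z.1 z.2.1 z.2.2).
Proof.
have Pn : PT (fun z : code_instance * (nat * nat) => order z.1) by apply: (pt_weaken pt_order); exact: pt_fst.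
have Pw : PT (fun z : code_instance * (nat * nat) => w1 z.1) by apply: (pt_weaken pt_w1); exact: pt_fst.
rewrite /edge_rel; pt.
Qed.

End Decoding.

(** * Trails on ordinals and on natural numbers *)

Section OrdinalTrails.
Variable x : instance.
Notation n := (order x).

Lemma edges_val (s : 'I_n) p : edges s (map val p) = map (fun a : 'I_n * 'I_n => (val a.1, val a.2)) (zip (s :: p) p).
Proof. by elim: p s => [|v p IH] s //=; rewrite IH. Qed.

Lemma trail_val (s t : 'I_n) p :
  is_trail (@adjacent x) s t p = trail (edge_rel x) s (map val p) && (last (val s) (map val p) == t).
Proof.
have inj : injective (fun a : 'I_n * 'I_n => (val a.1, val a.2)).
  by move=> [a b] [a' b'] /= [/val_inj -> /val_inj ->].
rewrite /is_trail /trail edges_val (map_inj_uniq inj) path_map last_map (inj_eq val_inj).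
rewrite (eq_path (e' := @adjacent x)) => [|i j]; last exact: edge_rel_ord.
by case: path => //=; rewrite andbC.
Qed.

(** Edges exist only below [order x], so a trail of numbers that starts at a vertex consists of
    vertices, and [insubd] lifts it unchanged. *)
Lemma trail_exists (Q : pred nat) (s t : 'I_n) :
  (exists p, is_trail (@adjacent x) s t p /\ Q (size p)) <->
  (exists p, [/\ trail (edge_rel x) s p, last (val s) p = t & Q (size p)]).
Proof.
split=> [[p []]|[p [tp lp sp]]].
  rewrite trail_val => /andP [tp /eqP lp] sp; exists (map val p).
  by rewrite size_map.
have /andP [pp _] := tp; have plt := path_lt (@edge_rel_lt x) (ltn_ord s) pp.
have E : map val (map (insubd s) p) = p.
  rewrite -map_comp; apply: map_id_in => v vp /=; rewrite val_insubd.
  by have /allP -> := plt; rewrite // inE vp orbT.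
exists (map (insubd s) p); split; last by rewrite size_map.
by rewrite trail_val E tp lp eqxx.
Qed.

End OrdinalTrails.

(** * The three trail problems *)

Lemma poly_branching : poly_bounded (fun x : code_instance => (param x).+1 ^ (param x + param x).+1).
Proof. by apply: (poly_le (@poly_meas code_instance)) => x; exact: leq_addl. Qed.

Lemma pt_prefixes : PT (fun x : code_instance =>
  representatives (order x) (edge_rel x) (param x) (param x + param x) (source x) (param x)).
Proof.
apply: (pt_representatives (X := code_instance) (e := edge_rel)).
- exact: pt_order.
- exact: pt_param.
- by apply: pt_addn; exact: pt_param.
- exact: pt_source.
- exact: pt_edge_rel.
- exact: poly_branching.
- exact: edge_rel_lt.
by move=> x; exact: ltn_ord.
Qed.

Lemma FPT_trail_exact : FPT trail_exact.
Proof.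
apply: (@FPT_of_pt _ (fun x => has (fun r => r.1 == target x :> nat)
  (representatives (order x) (edge_rel x) (param x) (param x + param x) (source x) (param x)))).
  have Pt := pt_target; have Pp := pt_prefixes.
  apply: (@pt_has_fun code_instance (code_prod code_nat (code_seq (code_prod code_nat code_nat)))) => //.
  by apply: pt_eqn; [apply: pt_fst_of; exact: pt_snd | apply: (pt_weaken Pt); exact: pt_fst].
move=> x; have H1 := exact_correct (@edge_rel_lt x) (source x) (target x) (leq_addr (param x) (param x)).
have H2 := trail_exists (fun m => m == param x) (source x) (target x).
split=> [/H1 [p [tp lp sp]]|[p [tp sp]]].
  by have /H2 [q [tq /eqP sq]] : exists p, [/\ trail (edge_rel x) (source x) p, last (val (source x)) p = target x
    & size p == param x]; [exists p; rewrite sp | exists q].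
by apply/H1; have /H2 [q [tq lq /eqP sq]] : exists p, is_trail (@adjacent x) (source x) (target x) p /\ size p == param x;
  [exists p; rewrite sp | exists q].
Qed.

Lemma FPT_trail_atmost : FPT trail_atmost.
Proof.
apply: (@FPT_of_pt _ (fun x => (target x : nat) \in reach (order x) (edge_rel x) [::] (param x) (source x))).
  apply: pt_mem_nat; first exact: pt_target.
  apply: (@pt_reach code_instance order param (fun x => source x) edge_rel (fun=> [::])).
  - exact: pt_order.
  - exact: pt_param.
  - exact: pt_source.
  - exact: pt_nil.
  exact: pt_edge_rel.
move=> x; have H1 := atmost_correct (@edge_rel_lt x) (param x) (target x) (ltn_ord (source x)).
apply: (iff_trans H1); apply: iff_sym.
exact: trail_exists (fun m => m <= param x) (source x) (target x).
Qed.

Lemma FPT_trail_atleast : FPT trail_atleast.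
Proof.
apply: (@FPT_of_pt _ (fun x => has (fun r => (target x : nat) \in reach (order x) (edge_rel x) r.2 (order x) r.1)
  (representatives (order x) (edge_rel x) (param x) (param x + param x) (source x) (param x)))).
  pose entry := code_prod code_nat (code_seq (code_prod code_nat code_nat)).
  have Pt := pt_target; have Pp := pt_prefixes.
  apply: (@pt_has_fun code_instance entry) => //.
  apply: pt_mem_nat; first by apply: (pt_weaken Pt); exact: pt_fst.
  have Po : PT (fun z : code_instance * entry => order z.1) by apply: (pt_weaken pt_order); exact: pt_fst.
  apply: (@pt_reach (code_prod code_instance entry) (fun z => order z.1) (fun z => order z.1)
    (fun z => z.2.1) (fun z => edge_rel z.1) (fun z => z.2.2)) => //; pt.
  by apply: (pt_comp (f := fun z => (z.1.1, (z.2.1, z.2.2))) pt_edge_rel); pt.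
move=> x; have H1 := atleast_correct (@edge_rel_lt x) (target x) (ltn_ord (source x)) (leqnn (param x + param x)).
apply: (iff_trans H1); apply: iff_sym.
exact: trail_exists (fun m => param x <= m) (source x) (target x).
Qed.

Theorem mainTheorem7 :
  FPT trail_exact /\ FPT trail_atmost /\ FPT trail_atleast.
Proof.
split; first exact: FPT_trail_exact.
by split; [exact: FPT_trail_atmost | exact: FPT_trail_atleast].
Qed.
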